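(* Let $\alpha=(\alpha_i)_{i\in\mathbb{N}^+}\in D[0,1]$ with $\sum_{i=1}^\infty\alpha_i\leq1$ and let $A\leqslant S_\alpha$ be a subgroup. Then for each $g\in\mathrm{Fin}(\mathbb{N})$, \[ \chi_{\nu_\alpha^A}(g)=\int_{\sigma\in\widehat{(S_\alpha/A)}}\chi_\alpha^\sigma(g)\,d\mu_\alpha^A . \]
   Context: $\mathbb{N} = \{0,1,2,\dots\}$ and $\mathbb{N}^+ = \{1,2,\dots\}$. For an infinite set $\Omega$, $\mathrm{Fin}(\Omega)$ is the group of permutations $g$ of $\Omega$ with $\mathrm{supp}(g)=\{\omega \in \Omega \mid g(\omega)\neq\omega\}$ finite; $\mathrm{sgn}(\pi)\in\{\pm1\}$ is the sign of a finitary permutation $\pi$. For $g\in\mathrm{Fin}(\mathbb{N})$ and $k\geq2$, $c_k(g)$ is the number of cycles of length $k$ in the cycle decomposition of $g$. For a countably infinite group $G$, $\mathrm{Sub}_G$ is the compact space of subgroups of $G$ (a closed subspace of $2^G$), on which $G$ acts by conjugation. An invariant random subgroup (IRS) of $G$ is a Borel probability measure $\nu$ on $\mathrm{Sub}_G$ which is invariant under this action. For an IRS $\nu$ of $G$, the associated character is $\chi_\nu(g)=\nu(\{H\in\mathrm{Sub}_G\mid g\in H\})$ for $g \in G$. $D[0,1]$ is the set of sequences $\alpha=(\alpha_1,\alpha_2,\dots)\in[0,1]^{\mathbb{N}^+}$ with $\alpha_1\geq\alpha_2\geq\cdots$. Let $\alpha\in D[0,1]$ with $\sum_{i=1}^\infty\alpha_i\leq1$.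 Put $\alpha_0=1-\sum_{i=1}^\infty\alpha_i$, let $p_\alpha$ be the probability measure on $\mathbb{N}$ with $p_\alpha(\{i\})=\alpha_i$, and let $\mu_\alpha$ be the corresponding product probability measure on $\mathbb{N}^{\mathbb{N}}$. $\mathrm{Fin}(\mathbb{N})$ acts on $(\mathbb{N}^{\mathbb{N}},\mu_\alpha)$ by $(g\cdot\xi)(n)=\xi(g^{-1}(n))$. For $\xi\in\mathbb{N}^{\mathbb{N}}$ and $i\in\mathbb{N}$ let $B_i^\xi=\{n\in\mathbb{N}\mid\xi(n)=i\}$. Call $\xi$ $\mu_\alpha$-generic if for all $i\in\mathbb{N}$ the following are equivalent: (a) $\alpha_i>0$; (b) $B_i^\xi\neq\emptyset$; (c) $B_i^\xi$ is infinite; (d) $\lim_{n\to\infty}|B_i^\xi\cap\{0,\dots,n-1\}|/n=\alpha_i>0$. ($\mu_\alpha$-a.e. $\xi$ is $\mu_\alpha$-generic.) Let $I=\{i\in\mathbb{N}^+\mid\alpha_i>0\}$. If $\alpha_0\neq1$ (so $I\neq\emptyset$), let $S_\alpha=\bigoplus_{i\in I}C_i$ be the restricted direct product of the multiplicative groups $C_i=\{\pm1\}$. For each subgroup $A\leqslant S_\alpha$ define $f_\alpha^A:\mathbb{N}^{\mathbb{N}}\to\mathrm{Sub}_{\mathrm{Fin}(\mathbb{N})}$, $\xi\mapsto H_\xi$, as follows: if $\xi$ is $\mu_\alpha$-generic then $H_\xi=s_\xi^{-1}(A)$, where $s_\xi:\bigoplus_{i\in I}\mathrm{Fin}(B_i^\xi)\to\bigoplus_{i\in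 I}C_i$ is the homomorphism $(\pi_i)\mapsto(\mathrm{sgn}(\pi_i))$ and $\bigoplus_{i\in I}\mathrm{Fin}(B_i^\xi)$ is regarded as a subgroup of $\mathrm{Fin}(\mathbb{N})$ in the obvious way (fixing every point outside $\bigcup_{i\in I}B_i^\xi$); otherwise $H_\xi=1$. Let $\nu_\alpha^A=(f_\alpha^A)_*\mu_\alpha$, which is an ergodic IRS of $\mathrm{Fin}(\mathbb{N})$. If $\alpha_0=1$, then $S_\alpha=1$ is the trivial group and $\nu_\alpha^{S_\alpha}=\delta_1$, the point mass at the trivial subgroup. $\widehat{S}_\alpha$ is the compact group of homomorphisms $\sigma:S_\alpha\to\{\pm1\}$ (with the topology of pointwise convergence). For $i\in I$, $c_i$ is the generator of $C_i\leqslant S_\alpha$ and $\sigma(i)=\sigma(c_i)$. For $\sigma\in\widehat{S}_\alpha$, $\chi_\alpha^\sigma$ is the function on $\mathrm{Fin}(\mathbb{N})$ given by \[ \chi_\alpha^\sigma(g)=\prod_{k=2}^\infty\Bigl(\sum_{i\in I}\sigma(i)^{k+1}\alpha_i^k\Bigr)^{c_k(g)} \] (with $0^0=1$ and empty sums equal to $0$). For a subgroup $A\leqslant S_\alpha$, $\widehat{(S_\alpha/A)}$ is the compact subgroup of those $\sigma\in\widehat{S}_\alpha$ with $\sigma(a)=1$ for all $a\in A$, and $\mu_\alpha^A$ is the Haar probability measure on $\widehat{(S_\alpha/A)}$. *)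

(* Defs.v *)
From HB Require Import structures.
From mathcomp Require Import all_boot all_order all_fingroup all_algebra.
From mathcomp Require Import finmap all_classical all_reals all_analysis.
Import Order.TTheory GRing.Theory Num.Theory.
Import numFieldNormedType.Exports.

Set Implicit Arguments.
Unset Strict Implicit.
Unset Printing Implicit Defensive.

Local Open Scope classical_set_scope.
Local Open Scope ring_scope.

Definition borel (T : ptopologicalType) : Type := g_sigma_algebraType (@open T).
HB.instance Definition _ (T : ptopologicalType) :=
  Measurable.copy (borel T) (g_sigma_algebraType (@open T)).

(* The group {1, -1}: the boolean b stands for (-1)^b, as for the sign
   [odd_perm] of a permutation. *)
Definition pm1 : Type := bool.
HB.instance Definition _ := Choice.copy pm1 bool.
HB.instance Definition _ := PointedTopological.copy pm1 bool.
HB.instance Definition _ := isGroup.Build pm1 addbA addFb addbF addbb addbb.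

Definition pm1_val {R : pzRingType} (b : pm1) : R := (-1) ^+ (b : bool).

(* The space Sub_G, topologized as a subspace of the product 2^G. *)
Definition subgroups (G : groupType) : set {ptws G -> bool} :=
  [set H | group_closed (H : {pred G})].
Definition SubSpace (G : groupType) : Type := set_type (@subgroups G).
HB.instance Definition _ (G : groupType) :=
  Topological.copy (SubSpace G) (set_type (@subgroups G)).

Definition mem_subgroup (G : groupType) (H : SubSpace G) : set G :=
  [set g | \val H g].

Section make_subgroup.
Context (G : groupType) (H : set G).
Hypotheses (H1 : H 1%g) (HV : forall x y, H x -> H y -> H (x * y^-1)%g).

Lemma make_subgroup_proof : ((fun g => `[< H g >]) : {ptws G -> bool}) \in @subgroups G.
Proof.
apply/mem_set; split; first exact/asboolP.
by move=> x y /asboolP Hx /asboolP Hy; apply/asboolP; exact: HV.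
Qed.

Definition make_subgroup : SubSpace G :=
  @exist _ (fun H : {ptws G -> bool} => H \in @subgroups G) _ make_subgroup_proof.
End make_subgroup.

Lemma trivial_subgroup_proof (G : groupType) (x y : G) :
  [set 1%g] x -> [set 1%g] y -> [set 1%g] (x * y^-1)%g.
Proof. by move=> -> -> /=; rewrite divg1. Qed.

Definition trivial_subgroup (G : groupType) : SubSpace G :=
  make_subgroup (erefl : [set 1%g] 1%g) (@trivial_subgroup_proof G).
HB.instance Definition _ (G : groupType) :=
  isPointed.Build (SubSpace G) (trivial_subgroup G).

Definition character {R : realType} (G : groupType)
    (nu : set (borel (SubSpace G)) -> \bar R) (g : G) : \bar R :=
  nu [set H : borel (SubSpace G) | mem_subgroup H g].

Record Fin := MkFin {
  fin_fun :> nat -> nat;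
  fin_inv : nat -> nat;
  fin_funK : cancel fin_fun fin_inv;
  fin_invK : cancel fin_inv fin_fun;
  fin_finite : finite_set [set n | fin_fun n != n] }.

Definition fin_supp (g : Fin) : set nat := [set n | g n != n].

HB.instance Definition _ := gen_eqMixin Fin.
HB.instance Definition _ := gen_choiceMixin Fin.

Lemma fin_eqP (g h : Fin) : g =1 h -> g = h.
Proof.
case: g h => [f f' fK f'K ff] [k k' kK k'K kk] /= fk.
have {}fk : f = k by apply/funext.
have f'k' : f' = k'.
  by apply/funext => n; rewrite -[n in LHS]k'K -fk fK.
by subst k k'; congr MkFin; exact: Prop_irrelevance.
Qed.

Section fin_group.

Lemma fin1_finite : finite_set [set n : nat | id n != n].
Proof. by rewrite (_ : [set _ | _] = set0) // -subset0 => n /=; rewrite eqxx. Qed.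

Definition fin1 : Fin :=
  @MkFin id id (fun=> erefl) (fun=> erefl) fin1_finite.

Lemma fin_inv_finite (g : Fin) : finite_set [set n | fin_inv g n != n].
Proof.
apply: sub_finite_set (fin_finite g) => n /=; apply: contra => /eqP gn.
by rewrite -{1}gn fin_funK.
Qed.

Definition fin_invg (g : Fin) : Fin :=
  MkFin (@fin_invK g) (@fin_funK g) (fin_inv_finite g).

Lemma fin_mul_finite (g h : Fin) : finite_set [set n | (g \o h) n != n].
Proof.
apply: (@sub_finite_set _ _ (fin_supp g `|` fin_supp h)); last first.
  by rewrite finite_setU; split; exact: fin_finite.
move=> n /= ghn; have [hn|] := eqVneq (h n) n; last by right.
by left; rewrite /fin_supp/= -{1}hn.
Qed.

Definition fin_mul (g h : Fin) : Fin :=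
  MkFin (can_comp (@fin_funK g) (@fin_funK h))
    (can_comp (@fin_invK h) (@fin_invK g)) (fin_mul_finite g h).

Lemma fin_mulA : associative fin_mul.
Proof. by move=> f g h; apply: fin_eqP. Qed.
Lemma fin_mul1g : left_id fin1 fin_mul.
Proof. by move=> g; apply: fin_eqP. Qed.
Lemma fin_mulg1 : right_id fin1 fin_mul.
Proof. by move=> g; apply: fin_eqP. Qed.
Lemma fin_mulVg : left_inverse fin1 fin_invg fin_mul.
Proof. by move=> g; apply: fin_eqP => n; exact: fin_funK. Qed.
Lemma fin_mulgV : right_inverse fin1 fin_invg fin_mul.
Proof. by move=> g; apply: fin_eqP => n; exact: fin_invK. Qed.

HB.instance Definition _ := isGroup.Build Fin
  fin_mulA fin_mul1g fin_mulg1 fin_mulVg fin_mulgV.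

End fin_group.

(* A finitary permutation fixing every n >= N restricts to 'S_N; its sign and
   its cycles of length at least 2 are those of its restriction. *)
Definition fixes_from (N : nat) (g : Fin) := forall n, (N <= n)%N -> g n = n.

Section restriction.
Context (N : nat) (g : Fin) (gN : fixes_from N g).

Lemma fin_ltn (n : nat) : (n < N)%N -> (g n < N)%N.
Proof.
move=> nN; rewrite ltnNge; apply/negP => Ngn.
have /(can_inj (@fin_funK g)) gn := gN Ngn.
by move: Ngn; rewrite gn leqNgt nN.
Qed.

Definition restr_fun (i : 'I_N) : 'I_N := Ordinal (fin_ltn (ltn_ord i)).

Lemma restr_fun_inj : injective restr_fun.
Proof. by move=> i j /(congr1 val)/= /(can_inj (@fin_funK g))/val_inj. Qed.

Definition restr : 'S_N := perm restr_fun_inj.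

End restriction.

Definition fin_bound (g : Fin) : nat :=
  \max_(n <- enum_fset (fset_set (fin_supp g))) n.+1.

Lemma boundP (g : Fin) : fixes_from (fin_bound g) g.
Proof.
move=> n; apply: contraTeq => gn; rewrite -ltnNge /fin_bound.
apply: (@leq_bigmax_seq _ _ xpredT (fun i => i.+1) n) => //.
by rewrite in_fset_set; [exact/mem_set|exact: fin_finite].
Qed.

Definition sgn (g : Fin) : pm1 := odd_perm (restr (@boundP g)).

Definition ncycles (k : nat) (g : Fin) : nat :=
  #|[set C in porbits (restr (@boundP g)) | #|C| == k]%SET|.

Lemma sgnE N (g : Fin) (gN : fixes_from N g) : sgn g = odd_perm (restr gN).
Proof.
have step M (gM : fixes_from M g) (gM1 : fixes_from M.+1 g) :
    odd_perm (restr gM1) = odd_perm (restr gM).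
  suff -> : restr gM1 = lift_perm ord_max ord_max (restr gM).
    by rewrite odd_lift_perm addbb addFb.
  apply/permP => i; apply/val_inj; rewrite permE /=.
  case: (unliftP ord_max i) => [j|] ->.
    rewrite lift_perm_lift permE /= /bump.
    rewrite [(M <= j)%N]leqNgt ltn_ord /= [(M <= g j)%N]leqNgt.
    by rewrite (fin_ltn gM).
  by rewrite lift_perm_id /= gM.
have ext M K (gM : fixes_from M g) (gK : fixes_from K g) : (M <= K)%N ->
    odd_perm (restr gK) = odd_perm (restr gM).
  move=> /subnKC MK; move: (K - M)%N MK gK => d <-.
  elim: d => [|d IHd].
    rewrite addn0 => gK; suff -> : restr gK = restr gM by [].
    by apply/permP => i; apply/val_inj; rewrite !permE.
  rewrite addnS => gK.
  have gd : fixes_from (M + d) g by move=> n /(leq_trans (leq_addr _ _)); apply: gM.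
  by rewrite step IHd.
rewrite /sgn; case: (leqP (fin_bound g) N) => [le_bN|/ltnW le_Nb].
  by rewrite (ext _ _ (@boundP g) gN le_bN).
by rewrite (ext _ _ gN (@boundP g) le_Nb).
Qed.

Lemma sgnM : {morph sgn : g h / (g * h)%g}.
Proof.
move=> g h; pose N := maxn (fin_bound g) (fin_bound h).
have gN : fixes_from N g.
  by move=> n /(leq_trans (leq_maxl _ _)); exact: boundP.
have hN : fixes_from N h.
  by move=> n /(leq_trans (leq_maxr _ _)); exact: boundP.
have ghN : fixes_from N (g * h)%g.
  by move=> n Nn; rewrite -[RHS](gN n)// -{2}(hN n).
rewrite (sgnE ghN) (sgnE gN) (sgnE hN).
have -> : restr ghN = (restr hN * restr gN)%g.
  by apply/permP => i; apply/val_inj; rewrite permM !permE.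
by rewrite odd_permM addbC.
Qed.

Lemma sgn1 : sgn 1%g = 1%g.
Proof. by apply: (@mulgI _ (sgn 1%g)); rewrite -sgnM !mulg1. Qed.

Lemma sgnV (g : Fin) : sgn g^-1%g = (sgn g)^-1%g.
Proof. by apply: (@mulgI _ (sgn g)); rewrite -sgnM !mulgV sgn1. Qed.

(* The restricted direct product of copies of G indexed by I, as the finitely
   supported functions on nat which are trivial outside I. *)
Record rdprod (I : pred nat) (G : groupType) := MkRdprod {
  rd_fun :> nat -> G;
  rd_out : forall i, ~~ I i -> rd_fun i = 1%g;
  rd_finite : finite_set [set i | rd_fun i != 1%g] }.

HB.instance Definition _ I G := gen_eqMixin (rdprod I G).
HB.instance Definition _ I G := gen_choiceMixin (rdprod I G).

Section rdprod_group.
Context (I : pred nat) (G : groupType).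
Implicit Types s t : rdprod I G.

Lemma rd_eqP s t : s =1 t -> s = t.
Proof.
case: s t => [s s1 sf] [t t1 tf] /= /funext st; subst t.
by congr MkRdprod; exact: Prop_irrelevance.
Qed.

Fact rd1_out i : ~~ I i -> 1%g = 1%g :> G. Proof. by []. Qed.
Fact rd1_finite : finite_set [set i : nat | 1%g != 1%g :> G].
Proof. by rewrite (_ : [set _ | _] = set0) // -subset0 => n /=; rewrite eqxx. Qed.
Definition rd1 : rdprod I G := MkRdprod rd1_out rd1_finite.

Fact rdV_out s i : ~~ I i -> (s i)^-1%g = 1%g.
Proof. by move=> /(rd_out s) ->; rewrite invg1. Qed.
Fact rdV_finite s : finite_set [set i | (s i)^-1%g != 1%g].
Proof.
apply: sub_finite_set (rd_finite s) => i /=.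
by apply: contra => /eqP ->; rewrite invg1.
Qed.
Definition rdV s : rdprod I G := MkRdprod (@rdV_out s) (@rdV_finite s).

Fact rdM_out s t i : ~~ I i -> (s i * t i)%g = 1%g.
Proof. by move=> Ii; rewrite !rd_out// mulg1. Qed.
Fact rdM_finite s t : finite_set [set i | (s i * t i)%g != 1%g].
Proof.
apply: (@sub_finite_set _ _ ([set i | s i != 1%g] `|` [set i | t i != 1%g])).
  move=> i /= st; have [si|] := eqVneq (s i) 1%g; last by left.
  by right; rewrite si mul1g in st.
by rewrite finite_setU; split; exact: rd_finite.
Qed.
Definition rdM s t : rdprod I G := MkRdprod (@rdM_out s t) (@rdM_finite s t).

Fact rd_mulA : associative rdM.
Proof. by move=> s t u; apply: rd_eqP => i; exact: mulgA. Qed.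
Fact rd_mul1g : left_id rd1 rdM.
Proof. by move=> s; apply: rd_eqP => i; exact: mul1g. Qed.
Fact rd_mulg1 : right_id rd1 rdM.
Proof. by move=> s; apply: rd_eqP => i; exact: mulg1. Qed.
Fact rd_mulVg : left_inverse rd1 rdV rdM.
Proof. by move=> s; apply: rd_eqP => i; exact: mulVg. Qed.
Fact rd_mulgV : right_inverse rd1 rdV rdM.
Proof. by move=> s; apply: rd_eqP => i; exact: mulgV. Qed.

HB.instance Definition _ := isGroup.Build (rdprod I G)
  rd_mulA rd_mul1g rd_mulg1 rd_mulVg rd_mulgV.

End rdprod_group.

Section rdprod_sgn.
Context (I : pred nat) (pi : rdprod I Fin).

Fact rd_sgn_out i : ~~ I i -> sgn (pi i) = 1%g.
Proof. by move=> Ii; rewrite rd_out// sgn1. Qed.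
Fact rd_sgn_finite : finite_set [set i | sgn (pi i) != 1%g].
Proof.
apply: sub_finite_set (rd_finite pi) => i /=.
by apply: contra => /eqP ->; rewrite sgn1.
Qed.
Definition rd_sgn : rdprod I pm1 := MkRdprod rd_sgn_out rd_sgn_finite.

End rdprod_sgn.

Section rdprod_gen.
Context (I : pred nat) (j : nat).

Let gen (i : nat) : pm1 := I j && (i == j).

Fact rd_gen_out i : ~~ I i -> gen i = 1%g.
Proof.
by move=> Ii; apply: negbTE; apply: contra Ii => /andP[Ij /eqP ->].
Qed.
Fact rd_gen_finite : finite_set [set i | gen i != 1%g].
Proof.
apply: (@sub_finite_set _ _ [set j]); last exact: finite_set1.
by move=> i /=; have [//|ij] := eqVneq i j; rewrite /gen (negbTE ij) andbF eqxx.
Qed.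

(* The generator of the j-th factor, for j in I. *)
Definition rd_gen : rdprod I pm1 := MkRdprod rd_gen_out rd_gen_finite.

End rdprod_gen.

(* For A a subset of S, the compact group of homomorphisms from S to {1, -1}
   which are trivial on A, with the topology of pointwise convergence. *)
Definition annihilator (S : groupType) (A : set S) : set {ptws S -> pm1} :=
  [set sigma | {morph sigma : x y / (x * y)%g} /\
               forall a, A a -> sigma a = 1%g].
Definition pm1_dual (S : groupType) (A : set S) : Type := set_type (annihilator A).
HB.instance Definition _ (S : groupType) (A : set S) :=
  Topological.copy (pm1_dual A) (set_type (annihilator A)).

Definition dual_fun (S : groupType) (A : set S) (sigma : pm1_dual A) : S -> pm1 :=
  \val sigma.
Coercion dual_fun : pm1_dual >-> Funclass.

Section dual_group.
Context (S : groupType) (A : set S).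
Implicit Types sigma tau : pm1_dual A.

Definition mk_dual (f : {ptws S -> pm1}) (fA : annihilator A f) : pm1_dual A :=
  @exist _ (fun f : {ptws S -> pm1} => f \in annihilator A) f (mem_set fA).

Fact dual_morph sigma : {morph sigma : x y / (x * y)%g}.
Proof. by have [] := set_mem (valP sigma). Qed.
Fact dual_triv sigma a : A a -> sigma a = 1%g.
Proof. by have [_] := set_mem (valP sigma); exact. Qed.
Fact dual_eqP sigma tau : sigma =1 tau -> sigma = tau.
Proof. by move=> /funext st; exact/val_inj. Qed.

Fact dual1_proof : annihilator A (fun=> 1%g).
Proof. by []. Qed.
Definition dual1 : pm1_dual A := mk_dual dual1_proof.

Fact dualM_proof sigma tau : annihilator A (fun x => (sigma x * tau x)%g).
Proof.
split=> [x y|a Aa]; last by rewrite !dual_triv.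
by rewrite !dual_morph; case: (sigma x) (sigma y) (tau x) (tau y) => [] [] [] [].
Qed.
Definition dualM sigma tau : pm1_dual A := mk_dual (dualM_proof sigma tau).

Fact dual_mulA : associative dualM.
Proof. by move=> s t u; apply: dual_eqP => x; exact: mulgA. Qed.
Fact dual_mul1g : left_id dual1 dualM.
Proof. by move=> s; apply: dual_eqP => x; exact: mul1g. Qed.
Fact dual_mulg1 : right_id dual1 dualM.
Proof. by move=> s; apply: dual_eqP => x; exact: mulg1. Qed.
Fact dual_mulVg : left_inverse dual1 id dualM.
Proof. by move=> s; apply: dual_eqP => x; exact: addbb. Qed.

HB.instance Definition _ := isPointed.Build (pm1_dual A) dual1.
HB.instance Definition _ := isGroup.Build (pm1_dual A)
  dual_mulA dual_mul1g dual_mulg1 dual_mulVg dual_mulVg.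

End dual_group.

Definition is_haar {R : realType} (S : groupType) (A : set S)
    (m : probability (borel (pm1_dual A)) R) : Prop :=
  forall (tau : pm1_dual A) (E : set (borel (pm1_dual A))), measurable E ->
    m [set (tau * sigma)%g | sigma in (E : set (pm1_dual A))] = m E.

(* nat -> nat with the product sigma-algebra, generated by the coordinates. *)
Definition seq_space : Type := g_sigma_algebraType
  [set [set xi : nat -> nat | E (xi n)] | n in [set: nat] & E in [set: set nat]].
HB.instance Definition _ := Measurable.on seq_space.

Definition block (xi : nat -> nat) (i : nat) : set nat := [set n | xi n = i].

Section alpha.
Context {R : realType}.

(* A sequence (alpha_1, alpha_2, ...) is given as a : nat -> R, where a i is
   alpha_(i+1). *)
Definition D01 (a : nat -> R) : Prop :=
  (forall i, 0 <= a i <= 1) /\ nonincreasing_seq a.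

Variable a : nat -> R.

Definition alpha (i : nat) : R :=
  if i is j.+1 then a j else 1 - fine (\sum_(0 <= j <oo) (a j)%:E)%E.

Definition p_alpha (E : set nat) : \bar R := \esum_(i in E) (alpha i)%:E.

Definition is_product_measure (mu : probability seq_space R) : Prop :=
  forall (n : nat) (E : nat -> set nat),
    mu [set xi : seq_space | forall k, (k < n)%N -> E k (xi k)] =
    (\prod_(k < n) p_alpha (E k))%E.

Definition mu_generic (xi : nat -> nat) : Prop :=
  forall i, [<-> 0 < alpha i;
                 block xi i !=set0;
                 infinite_set (block xi i);
                 (fun n => (#|[pred k : 'I_n | xi k == i]|%:R / n%:R : R))
                   @ \oo --> alpha i /\ 0 < alpha i].

Definition index_set : pred nat := fun i => (0 < i)%N && (0 < alpha i).

Definition S_alpha : groupType := rdprod index_set pm1.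

Section H_xi.
Context (A : SubSpace S_alpha) (xi : nat -> nat).

(* The family pi, with pi i supported in block i, is identified with the
   permutation g which agrees with pi i on block i; recall that pi i is the
   identity for i outside the index set. *)
Definition H_set : set Fin :=
  [set g | exists pi : rdprod index_set Fin,
    [/\ forall i, fin_supp (pi i) `<=` block xi i,
        forall i n, block xi i n -> g n = pi i n &
        mem_subgroup A (rd_sgn pi)]].

Fact H_set1 : H_set 1%g.
Proof.
exists 1%g; split=> [i n|//|] /=; first by rewrite /fin_supp/= eqxx.
have -> : rd_sgn (1%g : rdprod index_set Fin) = 1%g by apply: rd_eqP => i; exact: sgn1.
by have [] := set_mem (valP A).
Qed.

Fact H_setV (g h : Fin) : H_set g -> H_set h -> H_set (g * h^-1)%g.
Proof.
move=> [p [pB gp Ap]] [q [qB hq Aq]].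
have qV i n : block xi i n -> block xi i ((q i)^-1%g n).
  move=> xin; have [->//|qn] := eqVneq ((q i)^-1%g n) n.
  have qm : q i ((q i)^-1%g n) = n := fin_invK (q i) n.
  by apply: qB; change (q i ((q i)^-1%g n) != (q i)^-1%g n); rewrite qm eq_sym.
have hV i n : block xi i n -> h^-1%g n = (q i)^-1%g n.
  move=> /qV /hq hqn; apply: (can_inj (@fin_funK h)).
  by rewrite hqn [LHS](fin_invK h) [RHS](fin_invK (q i)).
exists (p * q^-1)%g; split=> [i n|i n xin|].
- rewrite /fin_supp /= => pqn; have [qn|qn] := eqVneq ((q i)^-1%g n) n.
    by apply: pB; rewrite /fin_supp /= -{1}qn.
  apply: qB; rewrite /fin_supp /=; apply: contra qn => /eqP qn.
  by apply/eqP; rewrite -{1}qn; exact: fin_funK.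
- change (g (h^-1%g n) = p i ((q i)^-1%g n)).
  by rewrite (hV _ _ xin); exact/gp/qV.
have -> : rd_sgn (p * q^-1)%g = (rd_sgn p * (rd_sgn q)^-1)%g.
  by apply: rd_eqP => i; rewrite /= sgnM sgnV.
by have [_ AV] := set_mem (valP A); exact: AV.
Qed.

Definition H_xi : SubSpace Fin := make_subgroup H_set1 H_setV.

End H_xi.

Definition f_alpha (A : SubSpace S_alpha) (xi : seq_space) : borel (SubSpace Fin) :=
  if `[< mu_generic xi >] then H_xi A xi else trivial_subgroup Fin.

Definition nu_alpha (A : SubSpace S_alpha) (mu : probability seq_space R) :
    set (borel (SubSpace Fin)) -> \bar R :=
  if alpha 0 == 1 then \d_(trivial_subgroup Fin : borel (SubSpace Fin))
  else pushforward mu (f_alpha A).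

(* The partial products are eventually constant, since ncycles k g = 0 for
   large k. *)
Definition chi_alpha (sigma : S_alpha -> pm1) (g : Fin) : R :=
  \big[*%R/1]_(2 <= k <oo)
    (\big[+%R/0]_(1 <= i <oo | index_set i)
        (pm1_val (sigma (rd_gen index_set i)) ^+ k.+1 * alpha i ^+ k))
      ^+ ncycles k g.

End alpha.

Arguments chi_alpha {R} a sigma g.

(* Main.v *)
Require Import Defs.
From mathcomp Require Import all_boot all_order all_fingroup all_algebra.
From mathcomp Require Import all_classical all_reals all_analysis.
From mathcomp Require Import measurable_realfun lra.
Import Order.TTheory GRing.Theory Num.Theory.
Import numFieldNormedType.Exports.

(** Whether a finitary permutation [g] belongs to the random subgroup [H_xi]
    depends on [xi] only through the colours of the points moved by [g].  For
    generic [xi], [g] is in [H_xi] exactly when every nontrivial cycle of [g] is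
    monochromatic, with a colour in the index set, and the vector of signs of
    the components of [g] on the blocks is in [A].  Let [c] be a colouring of
    the nontrivial cycles by elements of the index set.  The event that [xi] induces [c] is a cylinder of
    probability [prod_C alpha_(c C) ^ |C|] ([coloured_event_measure]), and on
    this event the sign vector is [s_c = prod_C gen_(c C) ^ (|C| + 1)], since a
    cycle of length [k] has sign [(-1) ^ (k + 1)] ([H_set_coloured]).  Hence

      character (g) = sum_c [s_c in A] prod_C alpha_(c C) ^ |C|.

    On the other side, expanding the product that defines [chi_alpha sigma g]
    gives [sum_c sigma (s_c) prod_C alpha_(c C) ^ |C|] ([chi_truncE]), and the
    integral of [sigma (s)] over the characters trivial on [A] is 1 or 0
    according to whether [s] is in [A] ([integral_dual_eval]): for [s] not in
    [A], some character trivial on [A] takes the value -1 at [s], and the Haar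
    measure is invariant under translation by it.  Integrating term by term
    yields the same sum.

    The two infinite sums are compared through their truncations to colours at
    most [K], which are finite sums: as [K] grows, one side converges by
    continuity of [mu] along an increasing union of events ([H_event_limit]),
    the other by dominated convergence, the truncated characters being bounded
    by 1 ([integral_chi_trunc_cvg]).

    The random subgroup is [H_xi] for generic [xi] only, so genericity has to be
    a measurable event of full measure ([measurable_generic],
    [ae_generic]).  This is the strong law of large numbers for the indicators
    of a colour: a Chernoff bound makes the probabilities of a fixed deviation
    decay geometrically ([mu_deviates]), and the Borel-Cantelli lemma
    concludes. *)

Set Implicit Arguments.
Unset Strict Implicit.
Unset Printing Implicit Defensive.

Local Open Scope classical_set_scope.
Local Open Scope ring_scope.

(** * Cycles and parity *)

Lemma mem_porbits_porbit (T : finType) (s : {perm T}) (C : {set T}) x :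
  C \in porbits s -> (porbit s x == C) = (x \in C).
Proof. by case/imsetP => y _ ->; rewrite eq_porbit_mem. Qed.

Lemma sum_card_porbits (T : finType) (s : {perm T}) :
  (\sum_(C in porbits s) #|C|)%N = #|T|.
Proof.
rewrite -sum1_card (partition_big (porbit s) (mem (porbits s))) /=; last first.
  by move=> x _; apply: imset_f.
apply: eq_bigr => C Cs; rewrite -sum1_card; apply: eq_bigl => x.
by rewrite mem_porbits_porbit.
Qed.

Definition cycles {T : finType} (s : {perm T}) : {set {set T}} :=
  [set C in porbits s | (1 < #|C|)%N]%SET.

Lemma cycles_porbits {T : finType} (s : {perm T}) C :
  C \in cycles s -> C \in porbits s.
Proof. by rewrite inE => /andP[]. Qed.

(** The parity of [s] is that of [#|T|] plus the number of orbits.  The orbit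
    sizes add up to [#|T|], so each orbit [C] contributes the parity of
    [#|C| + 1], which vanishes for fixed points. *)
Lemma odd_perm_cycles (T : finType) (s : {perm T}) :
  odd_perm s = \big[addb/false]_(C in cycles s) odd #|C|.+1.
Proof.
have -> : odd_perm s = odd (\sum_(C in porbits s) #|C|.+1)%N.
  under eq_bigr do rewrite -addn1.
  by rewrite big_split /= sum_card_porbits sum1_card oddD.
rewrite (big_morph odd oddD (erefl : odd 0 = false)).
rewrite (bigID [pred C : {set T} | (1 < #|C|)%N]) /= [X in _ (+) X]big1 ?addbF.
  by apply: eq_bigl => C; rewrite inE.
move=> C /andP[/imsetP[x _ ->]]; rewrite -leqNgt => le1.
suff -> : #|porbit s x| = 1%N by [].
by apply/eqP; rewrite eqn_leq le1 lt0n card_porbit_neq0.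
Qed.

Lemma card_porbit_gt1 (T : finType) (s : {perm T}) x :
  (1 < #|porbit s x|)%N = (s x != x).
Proof.
apply/idP/idP => [|sx].
  apply: contraTneq => sx; rewrite -leqNgt -(cards1 x); apply: subset_leq_card.
  apply/fintype.subsetP => y /porbitP[k ->]; rewrite inE; apply/eqP.
  by elim: k => [|k IH]; rewrite ?expg0 ?perm1 // expgSr permM IH.
rewrite ltnNge; apply: contra sx => le1; have := card_le1_eqP le1.
move=> H; rewrite (H x (s x)) // ?porbit_id //.
by have := mem_porbit s 1 x; rewrite expg1.
Qed.

Lemma porbit_cycles (T : finType) (s : {perm T}) x :
  (porbit s x \in cycles s) = (s x != x).
Proof. by rewrite inE imset_f //= card_porbit_gt1. Qed.

Lemma porbit_perm1 (T : finType) (s : {perm T}) x : porbit s (s x) = porbit s x.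
Proof. by have := porbit_perm s 1 x; rewrite expg1. Qed.

(** Here [t] is what remains of [s] on the points of colour [i]; as [s] preserves
    the colour, orbits of [s] meeting colour [i] are already orbits of [t]. *)
Lemma cycles_of_colour (T : finType) (s t : {perm T}) (col : T -> nat)
    (c : {set T} -> nat) (i : nat) :
    (forall x, s x != x -> col x = c (porbit s x)) ->
    (forall x, col x = i -> t x = s x) ->
    (forall x, col x <> i -> t x = x) ->
  cycles t = [set C in cycles s | c C == i]%SET.
Proof.
move=> colc ti tNi.
have cols x : col (s x) = col x.
  have [->//|sx] := eqVneq (s x) x.
  rewrite (colc _ sx) (colc (s x)) ?porbit_perm1 //.
  by apply: contra sx => /eqP/perm_inj ->.
have itr x k : col x = i -> (t ^+ k)%g x = (s ^+ k)%g x /\ col ((s ^+ k)%g x) = i.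
  move=> xi; elim: k => [|k [IH1 IH2]]; first by rewrite !expg0 !perm1.
  by rewrite !expgSr !permM IH1 ti // cols.
have orb x : col x = i -> porbit t x = porbit s x.
  move=> xi; apply/porbit_setP => y; apply/porbitP/porbitP => -[k ->]; exists k;
  by case: (itr x k xi).
apply/setP => C; apply/idP/idP; last first.
  rewrite !inE => /andP[/andP[/imsetP[x _ ->]]].
  rewrite card_porbit_gt1 => sx; rewrite -(colc _ sx) => /eqP xi.
  by rewrite -(orb _ xi) imset_f //= card_porbit_gt1 ti.
rewrite !inE => /andP[/imsetP[x _ ->]]; rewrite card_porbit_gt1 => tx.
have xi : col x = i by apply: contra_neqP tx => /tNi.
have sx : s x != x by rewrite -ti.
by rewrite (orb _ xi) imset_f //= tx -(colc _ sx) xi eqxx.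
Qed.

(** * Finitary permutations preserving a colouring *)

Section coloured_permutation.
Context (g : Fin).

Definition fin_perm : 'S_(fin_bound g) := restr (@boundP g).

(** Points fixed by [g] keep an arbitrary colour; this is why a cycle colouring
    determines a cylinder constraining only the support of [g]. *)
Definition coloured (c : {set 'I_(fin_bound g)} -> nat) (xi : nat -> nat) : Prop :=
  forall n : 'I_(fin_bound g), fin_perm n != n -> xi n = c (porbit fin_perm n).

Lemma fin_permE (n : 'I_(fin_bound g)) : fin_perm n = g n :> nat.
Proof. by rewrite /fin_perm permE. Qed.

Lemma fin_perm_moved (n : 'I_(fin_bound g)) : (fin_perm n != n) = (g n != n).
Proof. by rewrite -val_eqE /= fin_permE. Qed.

Lemma moved_lt_bound n : g n != n -> (n < fin_bound g)%N.
Proof. by apply: contraNT; rewrite -leqNgt => /boundP ->. Qed.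

Context (c : {set 'I_(fin_bound g)} -> nat) (xi : nat -> nat).
Hypothesis cxi : coloured c xi.

Lemma coloured_moved n : g n != n ->
  exists2 C, C \in cycles fin_perm & xi n = c C.
Proof.
move=> gn; pose n' := Ordinal (moved_lt_bound gn).
exists (porbit fin_perm n'); first by rewrite porbit_cycles fin_perm_moved.
by rewrite -(cxi (n := n')) // fin_perm_moved.
Qed.

Lemma coloured_invariant n : xi (g n) = xi n.
Proof.
have [->//|gn] := eqVneq (g n) n.
pose n' := Ordinal (moved_lt_bound gn).
have n'E : fin_perm n' != n' by rewrite fin_perm_moved.
rewrite -[X in xi X = _](fin_permE n') cxi ?porbit_perm1 -?cxi //.
by apply: contra n'E => /eqP/perm_inj ->.
Qed.

Lemma coloured_invariantV n : xi (fin_inv g n) = xi n.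
Proof. by rewrite -coloured_invariant fin_invK. Qed.

(** The component of [g] on the block of colour [i] has the cycles of [g] of that
    colour as its nontrivial cycles, whence its sign. *)
Lemma sgn_coloured_part (h : Fin) (i : nat) :
    (forall n, xi n = i -> h n = g n) -> (forall n, xi n <> i -> h n = n) ->
  sgn h = \big[addb/false]_(C in cycles fin_perm | c C == i) odd #|C|.+1.
Proof.
move=> hi hNi.
have hN : fixes_from (fin_bound g) h.
  by move=> n /boundP gn; have [/hi ->|/eqP/hNi] := eqVneq (xi n) i.
rewrite (sgnE hN) odd_perm_cycles.
rewrite (@cycles_of_colour _ fin_perm _ xi c i) => [||n /hi hn|n /hNi hn].
- by apply: eq_bigl => C; rewrite !inE.
- exact: cxi.
- by apply/val_inj; rewrite /= fin_permE permE.
- by apply/val_inj; rewrite permE.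
Qed.

Fact coloured_part_funK (i : nat) :
  cancel (fun n => if xi n == i then g n else n)
         (fun n => if xi n == i then fin_inv g n else n).
Proof.
move=> n /=; case: (boolP (xi n == i)) => xn; last by rewrite (negbTE xn).
by rewrite coloured_invariant xn fin_funK.
Qed.

Fact coloured_part_invK (i : nat) :
  cancel (fun n => if xi n == i then fin_inv g n else n)
         (fun n => if xi n == i then g n else n).
Proof.
move=> n /=; case: (boolP (xi n == i)) => xn; last by rewrite (negbTE xn).
by rewrite coloured_invariantV xn fin_invK.
Qed.

Fact coloured_part_finite (i : nat) :
  finite_set [set n | (if xi n == i then g n else n) != n].
Proof.
by apply: sub_finite_set (fin_finite g) => n /=; case: ifP; rewrite ?eqxx.
Qed.

Definition coloured_part (i : nat) : Fin :=
  MkFin (@coloured_part_funK i) (@coloured_part_invK i)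
    (@coloured_part_finite i).

Context (I : pred nat) (cI : forall C, C \in cycles fin_perm -> I (c C)).

Fact coloured_parts_out i : ~~ I i -> coloured_part i = 1%g.
Proof.
move=> Ii; apply: fin_eqP => n /=; case: ifP => // /eqP xn.
have [//|gn] := eqVneq (g n) n.
have [C /cI IC xC] := coloured_moved gn.
by move: Ii; rewrite -xn xC IC.
Qed.

Fact coloured_parts_finite : finite_set [set i | coloured_part i != 1%g].
Proof.
apply: (@sub_finite_set _ _ (xi @` fin_supp g)); last first.
  exact: finite_image (fin_finite g).
move=> i; apply: contra_neqP => Ni; apply: fin_eqP => n /=.
case: ifP => // /eqP xn; have [//|gn] := eqVneq (g n) n.
by exfalso; apply: Ni; exists n.
Qed.

Definition coloured_parts : rdprod I Fin :=
  MkRdprod coloured_parts_out coloured_parts_finite.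

Definition sign_vector : rdprod I pm1 :=
  \big[mulg/1%g]_(C in cycles fin_perm) (rd_gen I (c C) ^+ #|C|.+1)%g.

Lemma sign_vectorE i : sign_vector i =
  \big[addb/false]_(C in cycles fin_perm | c C == i) odd #|C|.+1.
Proof.
rewrite /sign_vector.
rewrite (@big_morph _ _ (fun s : rdprod I pm1 => s i) 1%g (@mulg pm1) 1%g mulg
  (fun _ _ => erefl) erefl).
rewrite [RHS]big_mkcondr /=; apply: eq_bigr => C /cI IC.
have -> k : (rd_gen I (c C) ^+ k)%g i = odd k && (c C == i) :> bool.
  elim: k => [//|k IH]; rewrite expgS.
  transitivity ((I (c C) && (i == c C)) (+) ((rd_gen I (c C) ^+ k)%g i : bool)).
    by [].
  by rewrite IH IC eq_sym /=; case: (c C == i); rewrite ?andbT ?andbF.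
by case: eqP; rewrite ?andbT ?andbF.
Qed.

End coloured_permutation.

(** Once the colours of the nontrivial cycles are known, membership of [g] in the
    random subgroup only depends on them: the family of components of [g] on the
    blocks is unique, and its signs form [sign_vector]. *)
Lemma H_set_coloured (R : realType) (a : nat -> R) (A : SubSpace (S_alpha a))
    (g : Fin) (c : {set 'I_(fin_bound g)} -> nat) (xi : nat -> nat) :
    (forall C, C \in cycles (fin_perm g) -> index_set a (c C)) ->
    coloured c xi ->
  H_set A xi g <-> mem_subgroup A (sign_vector c (index_set a)).
Proof.
move=> cI cxi; split.
  move=> [p [pB gp]]; suff -> : rd_sgn p = sign_vector c (index_set a) by [].
  apply: rd_eqP => i; rewrite (sign_vectorE cI) /=.
  apply: (sgn_coloured_part cxi) => [n /gp->//|n ni].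
  by apply/eqP; apply: contra_notT ni => /pB.
have -> : sign_vector c (index_set a) = rd_sgn (coloured_parts cxi cI).
  apply: rd_eqP => i; rewrite (sign_vectorE cI) /=; apply/esym.
  by apply: (sgn_coloured_part cxi) => n /= /eqP; [move=> ->|move=> /negbTE ->].
move=> Ap; exists (coloured_parts cxi cI); split=> // i n /=.
  by rewrite /fin_supp /=; case: ifP; rewrite ?eqxx // => /eqP.
by move=> <-; rewrite eqxx.
Qed.

(** Elements of the random subgroup preserve all blocks, so that the colour of a
    cycle can be read off at any of its points, and they move no point of
    colour 0. *)
Lemma H_set_colouring (R : realType) (a : nat -> R) (A : SubSpace (S_alpha a))
    (g : Fin) (xi : nat -> nat) : H_set A xi g ->
  coloured (fun C : {set 'I_(fin_bound g)} =>
    if [pick n in C] is Some n then xi n else 0%N) xi /\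
  forall n, g n != n -> index_set a (xi n).
Proof.
move=> [p [pB gp _]].
have inv n : xi (g n) = xi n.
  have [->//|gn] := eqVneq (g n) n.
  apply: (pB (xi n)); rewrite /fin_supp /= (gp (xi n) n erefl).
  apply: contra gn => /eqP /(can_inj (@fin_funK _)) pn.
  by rewrite (gp (xi n) n erefl) pn.
split=> [n _|n gn].
  case: pickP => [m|/(_ n)]; last by rewrite porbit_id.
  move=> /porbitP[k ->]; elim: k => [|k IH]; first by rewrite expg0 perm1.
  by rewrite expgSr permM fin_permE inv.
apply: contraNT gn => /(rd_out p) pn.
by rewrite (gp (xi n) n erefl) pn.
Qed.

(** * Orthogonality of the characters of an elementary abelian 2-group *)

Section separation.
Context (S : groupType) (A : SubSpace S) (s : S).
Hypotheses (S2 : forall x : S, (x * x)%g = 1%g) (As : ~ mem_subgroup A s).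

Let admissible : set (set S) := [set M | [/\ M 1%g,
  forall x y, M x -> M y -> M (x * y)%g, mem_subgroup A `<=` M & ~ M s]].

Lemma mulgC_exponent2 (x y : S) : (x * y = y * x)%g.
Proof.
have inv (z : S) : (z^-1 = z)%g by apply: (@mulgI _ z); rewrite mulgV S2.
by rewrite -[LHS]inv invgM !inv.
Qed.

(** The empty set is admitted alongside the subgroups only because the union of
    the empty chain has to qualify in Zorn's lemma. *)
Lemma exists_maximal_avoiding :
  exists2 M, admissible M & forall N, admissible N -> M `<=` N -> N `<=` M.
Proof.
have adA : admissible (mem_subgroup A).
  have [A1 AV] := set_mem (valP A); split => // x y Ax Ay.
  have := AV x y Ax Ay; suff -> : (y^-1 = y)%g by [].
  by apply: (@mulgI _ y); rewrite mulgV S2.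
have [] := @Zorn_bigcup S [set M | M = set0 \/ admissible M].
  move=> F FP Ftot; have [[X FX [X1 XM AX Xs]]|noX] :=
    pselect (exists2 X, F X & admissible X); last first.
    left; rewrite -subset0 => x [X FX Xx]; have [X0|adX] := FP _ FX.
      by rewrite X0 in Xx.
    by case: noX; exists X.
  right; split.
  - by exists X.
  - move=> x y [Y FY Yx] [Z FZ Zy].
    have clos W : F W -> W x -> W y -> (\bigcup_(V in F) V) (x * y)%g.
      move=> FW Wx Wy; exists W => //.
      by have [W0|[_ WM _ _]] := FP _ FW; [rewrite W0 in Wx|exact: WM].
    by have [YZ|ZY] := Ftot _ _ FY FZ; [apply: (clos Z) => //; exact: YZ
                                       |apply: (clos Y) => //; exact: ZY].
  - by move=> x /AX Xx; exists X.
  - move=> [Y FY Ys]; have [Y0|[]//] := FP _ FY.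
    by rewrite Y0 in Ys.
move=> M [[M0|adM] maxM].
  exfalso; apply: (maxM (mem_subgroup A)); last by right.
  rewrite M0; split=> [x|]; first by [].
  by case: adA => A1 _ _ _ /(_ _ A1).
exists M => // N adN MN; apply: contrapT => NM.
by apply: (maxM N); [split|right].
Qed.

(** A subgroup [M] containing [A] that is maximal among those avoiding [s] has
    index 2: for [x] outside [M], the subgroup generated by [M] and [x] is the
    union of [M] and [x M], and contains [s], so that [x s] is in [M].  The
    character with kernel [M] then separates [s] from [A]. *)
Lemma separating_character :
  exists tau : pm1_dual (mem_subgroup A), tau s = true :> bool.
Proof.
have [M [M1 MM AM Ms] maxM] := exists_maximal_avoiding.
have sM x : ~ M x -> M (x * s)%g.
  move=> Mx; apply: contrapT => Mxs.
  have xN : [set y | M y \/ M (y * x)%g] x by right; rewrite /= S2.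
  apply: Mx; apply: maxM xN; last by move=> y My; left.
  split.
  - by left.
  - move=> y z [My|Myx] [Mz|Mzx].
    + by left; exact: MM.
    + by right; rewrite -mulgA; exact: MM.
    + by right; rewrite -mulgA (mulgC_exponent2 z) mulgA; exact: MM.
    + left; have := MM _ _ Myx Mzx.
      by rewrite (mulgC_exponent2 z) -mulgA (mulgA x) S2 mul1g.
  - by move=> y /AM My; left.
  - by case=> // Msx; apply: Mxs; rewrite mulgC_exponent2.
pose tau (x : S) : pm1 := ~~ `[< M x >].
have tauA : annihilator (mem_subgroup A) tau.
  split=> [x y|x /AM Mx]; last by apply/negbTE; rewrite negbK; exact/asboolP.
  transitivity ((tau x : bool) (+) tau y : bool); last by [].
  rewrite /tau addbN addNb negbK.
  case: (pselect (M x)) => Mx; case: (pselect (M y)) => My.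
  - by rewrite !asboolT //; exact: MM.
  - rewrite (asboolT Mx) (asboolF My) asboolF // => Mxy; apply: My.
    by have := MM _ _ Mx Mxy; rewrite mulgA S2 mul1g.
  - rewrite (asboolF Mx) (asboolT My) asboolF // => Mxy; apply: Mx.
    by have := MM _ _ Mxy My; rewrite -mulgA S2 mulg1.
  - rewrite (asboolF Mx) (asboolF My) asboolT //.
    have := MM _ _ (sM _ Mx) (sM _ My).
    by rewrite (mulgC_exponent2 y) -mulgA (mulgA s) S2 mul1g.
exists (mk_dual tauA); rewrite /dual_fun /= /tau.
by apply/negP => /asboolP.
Qed.

End separation.

Section haar_orthogonality.
Context (R : realType) (S : groupType) (A : SubSpace S).
Context (m : probability (borel (pm1_dual (mem_subgroup A))) R).

Lemma open_dual_eval (s : S) (b : bool) :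
  open [set sigma : pm1_dual (mem_subgroup A) | sigma s = b :> bool].
Proof.
have cval : continuous
    (fun sigma : pm1_dual (mem_subgroup A) => \val sigma : {ptws S -> pm1}).
  exact: initial_continuous.
have ceval : continuous (fun f : {ptws S -> pm1} => f s).
  exact: proj_continuous.
have : open [set sigma : pm1_dual (mem_subgroup A) | [set b : pm1] (sigma s)].
  apply: (@open_comp _ _ (fun sigma : pm1_dual (mem_subgroup A) => sigma s : pm1)).
    move=> sigma _; exact: (continuous_comp (cval _) (ceval _)).
  exact: discrete_open.
by [].
Qed.

Definition dual_level (s : S) (b : bool) : set (borel (pm1_dual (mem_subgroup A))) :=
  [set sigma | (sigma : pm1_dual (mem_subgroup A)) s = b :> bool].

Lemma measurable_dual_level (s : S) (b : bool) : measurable (dual_level s b).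
Proof. by apply: sub_sigma_algebra; exact: open_dual_eval. Qed.

Lemma pm1_val_indic (s : S) (sigma : borel (pm1_dual (mem_subgroup A))) :
  pm1_val ((sigma : pm1_dual (mem_subgroup A)) s) =
  \1_(dual_level s false) sigma - \1_(dual_level s true) sigma :> R.
Proof.
rewrite !indicE /pm1_val.
have mE b : (sigma \in dual_level s b) =
    (((sigma : pm1_dual (mem_subgroup A)) s : bool) == b).
  by apply/idP/eqP => [/set_mem//|?]; exact/mem_set.
by rewrite !mE; case: ((sigma : pm1_dual _) s); rewrite /= ?expr0 ?expr1 ?subr0 ?sub0r.
Qed.

Lemma integrable_dual_eval (s : S) : m.-integrable setT
  (fun sigma => (pm1_val ((sigma : pm1_dual (mem_subgroup A)) s) : R)%:E).
Proof.
under eq_fun do rewrite pm1_val_indic EFinB.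
by apply: integrableB => //; apply: integrable_indic; exact: measurable_dual_level.
Qed.

(** If [s] is not in [A], translation by a character [tau] with [tau s = -1]
    exchanges the two level sets of the evaluation at [s], so they have the same
    measure and the integral vanishes. *)
Lemma integral_dual_eval (s : S) : (forall x : S, (x * x)%g = 1%g) -> is_haar m ->
  (\int[m]_sigma (pm1_val ((sigma : pm1_dual (mem_subgroup A)) s) : R)%:E)%E =
  (`[< mem_subgroup A s >]%:R)%:E.
Proof.
move=> S2 haar; have [As|As] := pselect (mem_subgroup A s).
  under eq_integral do rewrite dual_triv // /pm1_val expr0.
  rewrite integral_cst // asboolT // mul1e.
  exact: (probability_setT m).
have [tau taus] := separating_character S2 As.
have mE : m (dual_level s true) = m (dual_level s false).
  rewrite -[RHS](haar tau) //; last exact: measurable_dual_level.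
  congr (m _); apply/seteqP; split=> sigma.
    move=> ss; exists (tau * (sigma : pm1_dual (mem_subgroup A)))%g; last first.
      by apply: dual_eqP => x; exact: addKb.
    rewrite /dual_level /=; transitivity ((tau s : bool) (+)
      ((sigma : pm1_dual (mem_subgroup A)) s : bool)) => //.
    by rewrite taus ss.
  move=> [rho rs <-]; rewrite /dual_level /=.
  transitivity ((tau s : bool) (+) ((rho : pm1_dual (mem_subgroup A)) s : bool)).
    by [].
  by rewrite taus rs.
under eq_integral do rewrite pm1_val_indic EFinB.
rewrite integralB_EFin //; try by apply: integrable_indic; exact: measurable_dual_level.
have intE b : (\int[m]_sigma (\1_(dual_level s b) sigma)%:E)%E = m (dual_level s b).
  by rewrite integral_indic ?setIT //; exact: measurable_dual_level.
rewrite !intE mE subee ?asboolF //.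
by rewrite fin_num_measure //; exact: measurable_dual_level.
Qed.

End haar_orthogonality.

(** * Cylinders of the product space *)

Lemma measure_finite_disjoint (d : measure_display) (T : measurableType d)
    (R : realType) (mu : {measure set T -> \bar R}) (I : finType)
    (P : pred I) (F : I -> set T) :
    (forall i, P i -> measurable (F i)) ->
    (forall i j x, P i -> P j -> F i x -> F j x -> i = j) ->
  mu [set x | exists2 i, P i & F i x] = (\sum_(i | P i) mu (F i))%E.
Proof.
move=> mF dF.
have -> : [set x | exists2 i, P i & F i x] = \bigcup_(i in [set i | P i]) F i by [].
rewrite measure_fin_bigcup //=.
- rewrite (@fsbigE _ _ _ _ _ (enum P)) ?enum_uniq //.
  + rewrite big_enum_cond /=; apply: eq_bigl => i.
    apply/idP/idP => [/andP[_ /set_mem]//|Pi].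
    by apply/andP; split=> //; exact/mem_set.
  + by move=> i /=; rewrite mem_enum.
  + by move=> i Pi; rewrite mem_enum (Pi : i \in P).
- by move=> i j /= Pi Pj [x [Fi Fj]]; exact: dF Fi Fj.
Qed.

Section product_measure.
Context (R : realType) (a : nat -> R) (mu : probability seq_space R).
Hypothesis (prod_mu : is_product_measure a mu).
Hypothesis (alpha_ge0 : forall i, 0 <= alpha a i).

Lemma measurable_coord (n : nat) (E : set nat) :
  measurable [set xi : seq_space | E (xi n)].
Proof. by apply: sub_sigma_algebra; exists n => //; exists E. Qed.

Lemma measurable_cylinder (n : nat) (E : nat -> set nat) :
  measurable [set xi : seq_space | forall k, (k < n)%N -> E k (xi k)].
Proof.
have -> : [set xi : seq_space | forall k, (k < n)%N -> E k (xi k)] =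
    \bigcap_(k in `I_n) [set xi : seq_space | E k (xi k)] by [].
by apply: bigcap_measurableType => k _; exact: measurable_coord.
Qed.

Lemma p_alpha_coord (E : set nat) (n : nat) :
  mu [set xi : seq_space | E (xi n)] = p_alpha a E.
Proof.
have pT : p_alpha a setT = 1%E.
  have := prod_mu 1 (fun=> setT); rewrite big_ord1 => <-.
  rewrite (_ : [set _ | _] = setT) ?probability_setT //.
  by apply/seteqP; split.
have := prod_mu n.+1 (fun k => if k == n then E else setT).
rewrite big_ord_recr /= eqxx big1 ?mul1e => [<-|i _]; last first.
  by rewrite (ltn_eqF (ltn_ord i)).
congr (mu _); apply/seteqP; split=> xi /=.
  by move=> Exi k _; case: eqP => // ->.
by move/(_ n (leqnn _)); rewrite eqxx.
Qed.

Lemma p_alpha1 i : p_alpha a [set i] = (alpha a i)%:E.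
Proof. by rewrite /p_alpha esum_set1 // lee_fin. Qed.

(** The whole space is a cylinder with vacuous constraint at time 0, so the total
    mass of [p_alpha] follows from that of [mu] rather than from the series. *)
Lemma p_alphaT : p_alpha a setT = 1%E.
Proof.
rewrite -(p_alpha_coord _ 0) (_ : [set _ | _] = setT) ?probability_setT //.
Qed.

Lemma p_alphaC1 i : p_alpha a (~` [set i]) = (1 - alpha a i)%:E.
Proof.
rewrite -(p_alpha_coord _ 0) EFinB -p_alpha1 -(p_alpha_coord _ 0).
by rewrite -probability_setC //; exact: measurable_coord.
Qed.

Lemma sum_alpha_le1 n : \sum_(i < n) alpha a i <= 1.
Proof.
rewrite -lee_fin -sumEFin.
have -> : (\sum_(i < n) (alpha a i)%:E =
           \sum_(i < n) mu [set xi : seq_space | [set val i] (xi 0%N)])%E.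
  by apply: eq_bigr => i _; rewrite p_alpha_coord p_alpha1.
rewrite -(@measure_finite_disjoint _ _ _ mu 'I_n xpredT
  (fun i => [set xi : seq_space | [set val i] (xi 0%N)])).
- apply: probability_le1.
  rewrite (_ : [set _ | _] = [set xi : seq_space | `I_n (xi 0%N)]).
    exact: measurable_coord.
  apply/seteqP; split=> xi /=; first by move=> [i _ ->] /=.
  by move=> xn; exists (Ordinal xn).
- by move=> i _; exact: measurable_coord.
- by move=> i j xi _ _ /= -> /val_inj.
Qed.

Lemma alpha_le1 i : alpha a i <= 1.
Proof.
apply: le_trans (sum_alpha_le1 i.+1); rewrite big_ord_recr /= lerDr.
exact: sumr_ge0.
Qed.

Definition visits (i n : nat) (xi : seq_space) : {ffun 'I_n -> bool} :=
  [ffun k : 'I_n => xi k == i].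

Definition bernoulli_weight (p : R) (b : bool) : R := if b then p else 1 - p.

(** The visits to [i] are Bernoulli trials: the sequences with a given visit
    vector form a cylinder whose constraint at each time is [i] or its
    complement. *)
Lemma visits_event_measure (i n : nat) (Q : pred {ffun 'I_n -> bool}) :
  measurable [set xi | Q (visits i n xi)] /\
  mu [set xi | Q (visits i n xi)] =
    (\sum_(b | Q b) \prod_(k < n) bernoulli_weight (alpha a i) (b k))%:E.
Proof.
pose E (b : {ffun 'I_n -> bool}) (k : nat) : set nat :=
  [set x | forall k' : 'I_n, val k' = k -> (x == i) = b k'].
pose F b := [set xi : seq_space | forall k, (k < n)%N -> E b k (xi k)].
have FE b xi : F b xi <-> visits i n xi = b.
  split=> [Fb|<- k kn k' /=]; last by rewrite ffunE => ->.
  by apply/ffunP => k; rewrite ffunE; apply: (Fb k).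
have -> : [set xi | Q (visits i n xi)] = [set xi | exists2 b, Q b & F b xi].
  apply/seteqP; split=> xi /=; last by move=> [b Qb /FE ->].
  by move=> Qxi; exists (visits i n xi) => //; exact/FE.
split.
  have -> : [set xi | exists2 b, Q b & F b xi] =
      \bigcup_(b in [set b | Q b]) F b by [].
  by apply: fin_bigcup_measurable => // b _; exact: measurable_cylinder.
rewrite measure_finite_disjoint.
- rewrite -sumEFin; apply: eq_bigr => b _.
  rewrite -prodEFin [LHS]prod_mu; apply: eq_bigr => k _.
  case bk: (b k); rewrite /bernoulli_weight.
    rewrite -p_alpha1; congr (p_alpha a _); apply/seteqP; split=> x /=.
      by move/(_ k erefl); rewrite bk => /eqP.
    by move=> -> k' /val_inj ->; rewrite bk eqxx.
  rewrite -p_alphaC1; congr (p_alpha a _); apply/seteqP; split=> x /=.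
    by move/(_ k erefl); rewrite bk => /eqP.
  by move=> /eqP/negbTE xi k' /val_inj ->; rewrite bk.
- by move=> b _; exact: measurable_cylinder.
- by move=> b b' xi _ _ /FE <- /FE.
Qed.

End product_measure.

(** * The law of large numbers for the visits to a colour *)

(** Since [expR x <= 1 / (1 - x)], it suffices that
    [(1 + x + 2 x^2) (1 - x) = 1 + x^2 (1 - 2 x)] is at least 1. *)
Lemma expR_le_quadratic (R : realType) (x : R) : `|x| <= 1 / 2 ->
  expR x <= 1 + x + 2 * x ^+ 2.
Proof.
rewrite ler_norml => /andP[x1 x2].
have e1 : 1 - x <= expR (- x) by have := expR_ge1Dx (- x).
have e0 : 0 < expR x := expR_gt0 x.
have e2 : expR x * expR (- x) = 1 by rewrite -expRD subrr expR0.
have h : expR x * (1 - x) <= 1 by rewrite -[leRHS]e2 ler_wpM2l // ltW.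
have h2 : 1 <= (1 + x + 2 * x ^+ 2) * (1 - x).
  suff : 0 <= x ^+ 2 * (1 - 2 * x) by rewrite expr2; nra.
  by apply: mulr_ge0; [exact: sqr_ge0|lra].
have d0 : 0 < 1 - x by lra.
by rewrite -(ler_pM2r d0); exact: le_trans h h2.
Qed.

(** The linear terms of the quadratic bound cancel, because the centred Bernoulli
    variable has mean 0. *)
Lemma bernoulli_mgf (R : realType) (p t : R) : 0 <= p <= 1 -> `|t| <= 1 / 2 ->
  \sum_(b : bool) bernoulli_weight p b * expR (t * (b%:R - p)) <=
    expR (2 * t ^+ 2).
Proof.
move=> /andP[p0 p1] t2; rewrite big_bool /bernoulli_weight /=.
have aux x : `|x| <= 1 -> `|t * x| <= 1 / 2.
  by move=> x1; rewrite normrM; apply: le_trans t2; rewrite ler_piMr.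
have b1 : `|t * (1 - p)| <= 1 / 2.
  by apply: aux; rewrite ler_norml; apply/andP; split; lra.
have b2 : `|t * (0 - p)| <= 1 / 2.
  by apply: aux; rewrite ler_norml; apply/andP; split; lra.
apply: le_trans (expR_ge1Dx _).
have e1 := ler_wpM2l p0 (expR_le_quadratic b1).
have p1' : 0 <= 1 - p by lra.
have e2 := ler_wpM2l p1' (expR_le_quadratic b2).
apply: le_trans (lerD e1 e2) _.
rewrite -subr_ge0.
have -> : 1 + 2 * t ^+ 2 - (p * (1 + t * (1 - p) + 2 * (t * (1 - p)) ^+ 2) +
   (1 - p) * (1 + t * (0 - p) + 2 * (t * (0 - p)) ^+ 2)) =
   2 * t ^+ 2 * (1 - p * (1 - p)).
  by rewrite !expr2; lra.
have pp := sqr_ge0 p.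
apply: mulr_ge0; first by rewrite mulr_ge0 ?sqr_ge0.
rewrite expr2 in pp; nra.
Qed.

Definition deviation (R : realType) (p : R) n (b : {ffun 'I_n -> bool}) : R :=
  \sum_(k < n) ((b k)%:R - p).

(** Markov's inequality for the exponential of [t * deviation]; the resulting sum
    over visit vectors factorizes over the trials. *)
Lemma chernoff (R : realType) (p e : R) (t : R) n :
    0 <= p <= 1 -> `|t| <= 1 / 2 ->
  \sum_(b : {ffun 'I_n -> bool} | e <= t * deviation p b)
     \prod_(k < n) bernoulli_weight p (b k) <=
  expR (- e) * expR (2 * t ^+ 2) ^+ n.
Proof.
move=> p01 t2.
have w0 b : 0 <= bernoulli_weight p b.
  by case/andP: p01 => p0 p1; case: b => /=; rewrite ?subr_ge0.
pose W (b : {ffun 'I_n -> bool}) := \prod_(k < n) bernoulli_weight p (b k).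
have W0 b : 0 <= W b by apply: prodr_ge0.
apply: (@le_trans _ _ (\sum_b expR (t * deviation p b - e) * W b)).
  rewrite [leRHS](bigID (fun b => e <= t * deviation p b)) /=.
  rewrite -[leLHS]addr0 lerD //; last first.
    by apply: sumr_ge0 => b _; rewrite mulr_ge0 // expR_ge0.
  apply: ler_sum => b eb; rewrite ler_peMl ?W0 //.
  by rewrite -[leLHS]expR0 ler_expR subr_ge0.
have -> : \sum_b expR (t * deviation p b - e) * W b = expR (- e) *
    \sum_(b : {ffun 'I_n -> bool})
      \prod_(k < n) (bernoulli_weight p (b k) * expR (t * ((b k)%:R - p))).
  rewrite big_distrr; apply: eq_bigr => b _ /=.
  rewrite addrC expRD -mulrA; congr (_ * _).
  by rewrite big_split /= mulrC mulr_sumr expR_sum.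
rewrite -(bigA_distr_bigA
  (fun _ : 'I_n => fun b : bool => bernoulli_weight p b * expR (t * (b%:R - p)))).
rewrite ler_wpM2l ?expR_ge0 // prodr_const card_ord.
apply: lerXn2r; rewrite ?nnegrE ?expR_ge0 //; last exact: bernoulli_mgf.
by apply: sumr_ge0 => b _; rewrite mulr_ge0 // expR_ge0.
Qed.

Section law_of_large_numbers.
Context (R : realType) (a : nat -> R) (mu : probability seq_space R).
Hypothesis (prod_mu : is_product_measure a mu).
Hypothesis (alpha_ge0 : forall i, 0 <= alpha a i).

Definition deviates (i m n : nat) : set seq_space :=
  [set xi | m.+1%:R^-1 * n%:R <= `|deviation (alpha a i) (visits i n xi)|].

Lemma measurable_deviates i m n : measurable (deviates i m n).
Proof.
by have [] := visits_event_measure prod_mu alpha_ge0 i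
  (fun b : {ffun 'I_n -> bool} => m.+1%:R^-1 * n%:R <= `|deviation (alpha a i) b|).
Qed.

(** The Chernoff bound at [t = e / 4] and [t = - e / 4], with [e] the allowed
    deviation of the frequency: the exponent [2 t^2 - |t| e] equals [- e^2 / 8],
    and the factor 2 accounts for the two tails. *)
Lemma mu_deviates i m n :
  (mu (deviates i m n) <= (geometric 2 (expR (- (m.+1%:R^-1 ^+ 2 / 8))) n)%:E)%E.
Proof.
have [_] := visits_event_measure prod_mu alpha_ge0 i
  (fun b : {ffun 'I_n -> bool} => m.+1%:R^-1 * n%:R <= `|deviation (alpha a i) b|).
move=> ->; rewrite lee_fin /geometric /=.
set e := m.+1%:R^-1.
have e0 : 0 < e by rewrite invr_gt0 ltr0n.
have e1 : e <= 1 by rewrite invf_le1 ?ltr0n // ler1n.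
have p01 : 0 <= alpha a i <= 1 by rewrite alpha_ge0 (alpha_le1 prod_mu).
have bound s : `|s| = e / 4 ->
  \sum_(b : {ffun 'I_n -> bool} | e ^+ 2 / 4 * n%:R <= s * deviation (alpha a i) b)
     \prod_(k < n) bernoulli_weight (alpha a i) (b k) <=
  expR (- (e ^+ 2 / 8)) ^+ n.
  move=> se; apply: le_trans (chernoff _ _ p01 _) _; first by rewrite se; lra.
  rewrite -(real_normK (num_real s)) se -expRM_natl -expRM_natl -expRD ler_expR.
  by rewrite !expr2 le_eqVlt; apply/orP; left; apply/eqP; lra.
have s1 : `|e / 4| = e / 4 by rewrite ger0_norm //; lra.
have s2 : `|- (e / 4)| = e / 4 by rewrite normrN.
have := lerD (bound _ s1) (bound _ s2).
rewrite mulr_natl mulr2n; apply: le_trans.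
rewrite big_mkcond [X in _ <= X + _]big_mkcond [X in _ <= _ + X]big_mkcond.
rewrite -big_split /=; apply: ler_sum => b _.
set D := deviation _ _; set w := \prod_(k < n) _.
have w0 : 0 <= w.
  apply: prodr_ge0 => k _; case/andP: p01 => p0 p1.
  by case: (b k); rewrite /= ?subr_ge0.
have key : e * n%:R <= `|D| -> (e ^+ 2 / 4 * n%:R <= e / 4 * D) ||
    (e ^+ 2 / 4 * n%:R <= - (e / 4) * D).
  have [D0|D0] := leP 0 D; rewrite ?(ger0_norm D0) ?(ltr0_norm D0) => eD;
    have := ler_wpM2l (ltW e0) eD; rewrite expr2 => eeD.
    by apply/orP; left; lra.
  by apply/orP; right; lra.
case: ifP => [/key|_]; last by rewrite addr_ge0 //; case: ifP.
by case/orP => ->; rewrite ?lerDl ?lerDr //; case: ifP.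
Qed.

(** Borel-Cantelli, the deviation probabilities being bounded by a geometric
    series. *)
Lemma mu_deviates_io i m : mu (lim_sup_set (deviates i m)) = 0%E.
Proof.
apply: lim_sup_set_cvg0 => [n|]; first exact: measurable_deviates.
set rho := expR (- (m.+1%:R^-1 ^+ 2 / 8)) : R.
have rho1 : `|rho| < 1.
  rewrite ger0_norm ?expR_ge0 // -[ltRHS]expR0 ltr_expR oppr_lt0.
  by rewrite divr_gt0 // exprn_gt0 // invr_gt0 ltr0n.
apply: (@le_lt_trans _ _ (\sum_(n <oo) (geometric 2 rho n)%:E)%E).
  by apply: lee_nneseries => // n _; exact: mu_deviates.
have -> : (\sum_(n <oo) (geometric 2 rho n)%:E)%E =
    (limn (series (geometric 2 rho)))%:E.
  rewrite -EFin_lim; last exact: is_cvg_geometric_series.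
  by congr (limn _); apply/funext => n /=; rewrite -sumEFin.
exact: ltry.
Qed.

End law_of_large_numbers.

(** * Generic sequences *)

Definition frequency (R : realType) (xi : nat -> nat) (i n : nat) : R :=
  #|[pred k : 'I_n | xi k == i]|%:R / n%:R.

Lemma deviationE (R : realType) (p : R) (xi : seq_space) (i n : nat) :
  deviation p (visits i n xi) = n%:R * (frequency R xi i n - p).
Proof.
have nf : n%:R * frequency R xi i n = #|[pred k : 'I_n | xi k == i]|%:R.
  rewrite /frequency; case: n => [|n]; last by rewrite mulrC divfK ?pnatr_eq0.
  by rewrite mul0r eq_card0 // => -[].
transitivity (#|[pred k : 'I_n | xi k == i]|%:R - n%:R * p); last first.
  by rewrite -nf -mulrBr.
rewrite /deviation sumrB sumr_const card_ord -[p *+ n]mulr_natl; congr (_ - _).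
rewrite -sum1_card natr_sum [RHS]big_mkcond /=.
by apply: eq_bigr => k _; rewrite ffunE inE; case: (xi k == i).
Qed.

Section genericity.
Context (R : realType) (a : nat -> R) (mu : probability seq_space R).
Hypothesis (prod_mu : is_product_measure a mu).
Hypothesis (alpha_ge0 : forall i, 0 <= alpha a i).

Lemma deviatesN (i m n : nat) (xi : seq_space) : (0 < n)%N ->
  ~ deviates a i m n xi <-> `|alpha a i - frequency R xi i n| < m.+1%:R^-1.
Proof.
move=> n0; rewrite /deviates /= deviationE normrM normr_nat distrC mulrC.
have n0' : 0 < n%:R :> R by rewrite ltr0n.
by rewrite ler_pM2l // ltNge; split=> /negP.
Qed.

Lemma frequency_cvgP (i : nat) (xi : seq_space) :
  (frequency R xi i @ \oo --> alpha a i) <->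
  forall m, ~ lim_sup_set (deviates a i m) xi.
Proof.
split=> [/cvgrPdist_lt fa m | Nd].
  have m0 : 0 < m.+1%:R^-1 :> R by rewrite invr_gt0 ltr0n.
  have [N _ NP] := fa _ m0 => /(_ (maxn N 1) I) [n /=].
  rewrite geq_max => /andP[Nn n0]; apply/deviatesN => //; exact: NP.
apply/cvgrPdist_lt => e e0.
have [m me] : exists m : nat, m.+1%:R^-1 < e.
  by have [m _ me] := near_infty_natSinv_lt (PosNum e0); exists m; apply: me => /=.
have [N NP] : exists N, forall n, (N <= n)%N -> ~ deviates a i m n xi.
  apply: contrapT => H; apply: (Nd m) => N _; apply: contrapT => H2; apply: H.
  by exists N => n Nn dn; apply: H2; exists n.
exists (maxn N 1) => // n /=; rewrite geq_max => /andP[Nn n0].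
by apply: lt_trans me; apply/deviatesN => //; exact: NP.
Qed.

(** A finite block has a bounded number of visits, which forces frequency 0. *)
Lemma frequency_gt0_infinite (i : nat) (xi : nat -> nat) :
    0 < alpha a i -> frequency R xi i @ \oo --> alpha a i ->
  infinite_set (block xi i).
Proof.
move=> a0 fa finB; pose M := size (finmap.enum_fset (fset_set (block xi i))).
have countM n : (#|[pred k : 'I_n | xi k == i]| <= M)%N.
  rewrite cardE -(size_map val); apply: uniq_leq_size.
    by rewrite (map_inj_uniq val_inj) enum_uniq.
  move=> k /mapP[k' + ->]; rewrite mem_enum => /eqP xk.
  by rewrite in_fset_set //; exact/mem_set.
have a2 : 0 < alpha a i / 2 by rewrite divr_gt0.
move: fa => /cvgrPdist_lt/(_ _ a2)[N _ NP].
(* Beyond time K, the at most M visits give a frequency below alpha a i / 2. *)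
pose K := Num.Def.archi_bound (M%:R / (alpha a i / 2)).
have KM : M%:R < K%:R * (alpha a i / 2).
  by rewrite -ltr_pdivrMr // archi_boundP // divr_ge0 // ltW.
have := NP (maxn N K.+1) (leq_maxl _ _); set n := maxn N K.+1.
have n0 : 0 < n%:R :> R by rewrite ltr0n (leq_trans _ (leq_maxr _ _)).
rewrite /= ltr_norml => /andP[_]; apply/negP; rewrite -leNgt.
have le1 : frequency R xi i n <= alpha a i / 2.
  rewrite ler_pdivrMr //; apply: (@le_trans _ _ M%:R); first by rewrite ler_nat.
  apply: le_trans (ltW KM) _; rewrite mulrC ler_wpM2l ?(ltW a2) // ler_nat.
  by rewrite (leq_trans _ (leq_maxr _ _)).
by lra.
Qed.

(** A single condition equivalent to the four-fold equivalence in the definition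
    of genericity; it is visibly measurable. *)
Definition typical (i : nat) (xi : seq_space) : Prop :=
  if 0 < alpha a i then forall m, ~ lim_sup_set (deviates a i m) xi
  else forall k, xi k <> i.

Lemma mu_genericP (xi : seq_space) :
  mu_generic a xi <-> forall i, typical i xi.
Proof.
split=> [gen i|typ i].
  have [ab [bc [cd da]]] := gen i; rewrite /typical; case: ifPn => a0.
    by have [/frequency_cvgP fa _] := cd (bc (ab a0)).
  by move=> k xk; move/negP: a0; apply; apply/da/cd/bc; exists k.
have := typ i; rewrite /typical; case: ifPn => a0 typi.
  have /frequency_cvgP fa := typi.
  have inf := frequency_gt0_infinite a0 fa.
  by tfae => // _; exact: infinite_setN0.
have empty : ~ (block xi i !=set0) by move=> [k xk]; exact: (typi k).
tfae.
- by move/negP: a0.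
- by move/empty.
- by move/infinite_setN0/empty.
- by case.
Qed.

Lemma measurable_generic : measurable [set xi : seq_space | mu_generic a xi].
Proof.
have -> : [set xi : seq_space | mu_generic a xi] = \bigcap_i typical i.
  apply/seteqP; split=> xi /=; first by move=> /mu_genericP typ i _; exact: typ.
  by move=> typ; apply/mu_genericP => i; exact: typ.
apply: bigcap_measurableType => i _; rewrite /typical; case: (0 < alpha a i).
  have -> : (fun xi => forall m, ~ lim_sup_set (deviates a i m) xi) =
      \bigcap_m ~` lim_sup_set (deviates a i m) :> set seq_space.
    by apply/seteqP; split=> xi /=; [move=> h m _; exact: h|move=> h m; exact: h].
  apply: bigcap_measurableType => m _; apply: measurableC.
  apply: bigcap_measurableType => N _; apply: bigcup_measurable => n _.
  exact: (measurable_deviates prod_mu).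
have -> : (fun xi => forall k, xi k <> i) =
    \bigcap_k [set xi : seq_space | (~` [set i]) (xi k)] :> set seq_space.
  by apply/seteqP; split=> xi /=; [move=> h k _; exact: h|move=> h k; exact: h].
by apply: bigcap_measurableType => k _; exact: measurable_coord.
Qed.

Lemma ae_generic : {ae mu, forall xi : seq_space, mu_generic a xi}.
Proof.
suff : {ae mu, forall xi : seq_space, forall i, typical i xi}.
  by apply: filterS => xi /mu_genericP.
apply: ae_foralln => i; rewrite /typical; case: (boolP (0 < alpha a i)) => a0.
  apply: ae_foralln => m; exists (lim_sup_set (deviates a i m)); split.
  - apply: bigcap_measurableType => N _; apply: bigcup_measurable => n _.
    exact: (measurable_deviates prod_mu).
  - exact: (mu_deviates_io prod_mu).
  - by move=> xi /= /contrapT.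
apply: ae_foralln => k; exists [set xi : seq_space | [set i] (xi k)]; split.
- exact: measurable_coord.
- apply: (etrans (p_alpha_coord prod_mu [set i] k)).
  rewrite p_alpha1 //; congr _%:E; apply/eqP.
  by rewrite eq_le alpha_ge0 andbT leNgt.
- by move=> xi /= /contrapT.
Qed.

End genericity.

(** * Expansion of the character of the random subgroup over cycle colourings *)

Section colour_expansion.
Context (R : realType) (a : nat -> R) (mu : probability seq_space R).
Hypothesis (prod_mu : is_product_measure a mu).
Hypothesis (alpha_ge0 : forall i, 0 <= alpha a i).
Context (A : SubSpace (S_alpha a)) (g : Fin).

Local Notation N := (fin_bound g).
Local Notation J := (cycles (fin_perm g)).
Local Notation I := (index_set a).

Definition colour_weight (c : {set 'I_N} -> nat) : R :=
  \prod_(C in J) alpha a (c C) ^+ #|C|.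

(** The points moved by [g] are the points of its nontrivial cycles, and each
    point of a cycle [C] imposes one constraint of probability
    [alpha a (c C)]. *)
Lemma coloured_event_measure (c : {set 'I_N} -> nat) :
  measurable [set xi : seq_space | coloured c xi] /\
  mu [set xi : seq_space | coloured c xi] = (colour_weight c)%:E.
Proof.
pose E (k : nat) : set nat := [set x | forall n : 'I_N, val n = k ->
  fin_perm g n != n -> x = c (porbit (fin_perm g) n)].
have -> : [set xi : seq_space | coloured c xi] =
    [set xi : seq_space | forall k, (k < N)%N -> E k (xi k)].
  apply/seteqP; split=> xi /=; first by move=> cxi k kN n <- gn; exact: cxi.
  by move=> Exi n gn; exact: (Exi n (ltn_ord n) n).
split; first exact: measurable_cylinder.
rewrite prod_mu; have pE (n : 'I_N) : p_alpha a (E n) =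
    (if fin_perm g n != n then alpha a (c (porbit (fin_perm g) n)) else 1)%:E.
  case: ifPn => [gn|/negPn gn].
    rewrite -p_alpha1 //; congr (p_alpha a _); apply/seteqP; split=> x /=.
      by move/(_ n erefl gn).
    by move=> -> n' /val_inj ->.
  rewrite -(p_alphaT prod_mu); congr (p_alpha a _); apply/seteqP; split=> x //= _.
  by move=> n' /val_inj ->; rewrite gn.
under eq_bigr do rewrite pE.
rewrite prodEFin -big_mkcond (partition_big (porbit (fin_perm g)) (mem J)) /=.
  congr _%:E; apply: eq_bigr => C CJ; rewrite -prodr_const.
  apply: eq_big => n.
    have CP := cycles_porbits CJ.
    rewrite mem_porbits_porbit //; apply/idP/idP => [/andP[]//|nC].
    rewrite nC andbT -porbit_cycles.
    by move: nC; rewrite -(mem_porbits_porbit _ CP) => /eqP ->.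
  by move=> /andP[_ /eqP ->].
by move=> n gn; rewrite porbit_cycles.
Qed.

(** Bounding the colours by [K] makes the set of colourings finite, so that sums
    over colourings commute with integrals for free.  The default colour outside
    the nontrivial cycles makes distinct colourings describe disjoint events. *)
Definition colourings (K : nat) : {pred {ffun {set 'I_N} -> 'I_K.+1}} :=
  pfamily ord0 (mem J) (fun _ (i : 'I_K.+1) => I i).
Arguments colourings : clear implicits.

Definition colour_fun K (f : {ffun {set 'I_N} -> 'I_K.+1}) : {set 'I_N} -> nat :=
  fun C => f C.

Definition colour_sign K (f : {ffun {set 'I_N} -> 'I_K.+1}) : S_alpha a :=
  sign_vector (colour_fun f) I.

Lemma colouringsP K (f : {ffun {set 'I_N} -> 'I_K.+1}) : f \in colourings K ->
  forall C, C \in J -> I (colour_fun f C).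
Proof. by move=> /pfamilyP[_ fI] C /fI. Qed.

Definition bounded_event (K : nat) : set seq_space :=
  [set xi | exists2 f : {ffun {set 'I_N} -> 'I_K.+1},
     (f \in colourings K) && `[< mem_subgroup A (colour_sign f) >] &
     coloured (colour_fun f) xi].

Lemma bounded_eventP K xi : bounded_event K xi <->
  H_set A xi g /\ forall n, g n != n -> (xi n <= K)%N.
Proof.
split=> [[f /andP[fK /asboolP Af] fxi]|[Hxi xiK]].
  split; first by apply/(H_set_coloured A (colouringsP fK) fxi).
  by move=> n /(coloured_moved fxi)[C _ ->]; rewrite -ltnS ltn_ord.
have [cxi Ixi] := H_set_colouring Hxi.
move: cxi; set c := (X in coloured X) => cxi.
have cK C : C \in J -> exists2 n, g n != n & c C = xi n.
  rewrite inE => /andP[/imsetP[n _ ->]]; rewrite card_porbit_gt1 => gn.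
  by exists n; rewrite -?fin_perm_moved // -cxi.
pose f : {ffun {set 'I_N} -> 'I_K.+1} :=
  [ffun C => if C \in J then inord (c C) else ord0].
have fE C : C \in J -> colour_fun f C = c C.
  move=> CJ; rewrite /colour_fun ffunE CJ inordK //.
  by have [n gn ->] := cK _ CJ; rewrite ltnS xiK.
have fK : f \in colourings K.
  apply/pfamilyP; split.
    apply/supportP => C CJ; rewrite ffunE; case: ifP => // CJ'.
    by rewrite CJ' in CJ.
  move=> C CJ; change (is_true (I (colour_fun f C))).
  by rewrite fE //; have [n gn ->] := cK _ CJ; exact: Ixi.
have fxi : coloured (colour_fun f) xi.
  by move=> n gn; rewrite fE ?porbit_cycles //; exact: cxi.
exists f => //; rewrite fK; apply/asboolP.
exact/(H_set_coloured A (colouringsP fK) fxi).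
Qed.

Lemma bounded_event_measure K : measurable (bounded_event K) /\
  mu (bounded_event K) = (\sum_(f in colourings K)
    colour_weight (colour_fun f) * `[< mem_subgroup A (colour_sign f) >]%:R)%:E.
Proof.
split.
  have -> : bounded_event K =
    \bigcup_(f in [set f | (f \in colourings K) &&
        `[< mem_subgroup A (colour_sign f) >]])
      [set xi : seq_space | coloured (colour_fun f) xi] by [].
  apply: fin_bigcup_measurable => // f _.
  by have [] := coloured_event_measure (colour_fun f).
rewrite measure_finite_disjoint.
- rewrite big_mkcondr /= -sumEFin; apply: eq_bigr => f _.
  have [_ ->] := coloured_event_measure (colour_fun f).
  by case: asboolP; rewrite ?mulr1 ?mulr0.
- by move=> f _; have [] := coloured_event_measure (colour_fun f).
- move=> f f' xi /andP[fK _] /andP[f'K _] /= fxi f'xi.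
  case/pfamilyP: fK => /supportP f0 _; case/pfamilyP: f'K => /supportP f'0 _.
  apply/ffunP => C; have [CJ|CJ] := boolP (C \in J); last by rewrite f0 ?f'0.
  apply/val_inj; move: CJ; rewrite inE => /andP[/imsetP[n _ ->]].
  rewrite card_porbit_gt1 => gn.
  by rewrite -[LHS](fxi n gn) -[RHS](f'xi n gn).
Qed.

Lemma H_event_limit : measurable [set xi : seq_space | H_set A xi g] /\
  mu (bounded_event K) @[K --> \oo] --> mu [set xi : seq_space | H_set A xi g].
Proof.
have -> : [set xi : seq_space | H_set A xi g] = \bigcup_K bounded_event K.
  apply/seteqP; split=> xi /=; last by move=> [K _ /bounded_eventP[]].
  move=> Hxi; exists (\max_(n < N) xi n) => //; apply/bounded_eventP; split=> // n.
  by move=> /moved_lt_bound nN; exact: (leq_bigmax (Ordinal nN)).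
have mB K : measurable (bounded_event K) by have [] := bounded_event_measure K.
have mU : measurable (\bigcup_K bounded_event K) by exact: bigcup_measurable.
split=> //; apply: nondecreasing_cvg_mu => // K L KL; apply/subsetPset => xi.
move=> /bounded_eventP[Hxi xiK]; apply/bounded_eventP; split=> // n /xiK.
by move=> h; exact: leq_trans h KL.
Qed.

(** Almost every sequence is generic, and replacing the trivial subgroup by
    [H_set] on a null set does not change the measure.  When [alpha a 0 = 1] the
    index set is empty and [H_set] is trivial for every sequence, in agreement
    with the point mass. *)
Lemma character_H_event :
  character (nu_alpha A mu) g = mu [set xi : seq_space | H_set A xi g].
Proof.
have [mH _] := H_event_limit; rewrite /character.
pose F := [set xi : seq_space | mem_subgroup (f_alpha A xi) g].
have trivE : mem_subgroup (trivial_subgroup Fin) g <-> g = 1%g.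
  by split=> [/asboolP|g1]; [|apply/asboolP].
have FE xi : mu_generic a xi -> F xi <-> H_set A xi g.
  by move=> gen; rewrite /F /= /f_alpha asboolT //; split=> [/asboolP|h]; [|apply/asboolP].
have FNE xi : ~ mu_generic a xi -> F xi <-> g = 1%g.
  by move=> gen; rewrite /F /= /f_alpha asboolF.
have mG := measurable_generic prod_mu alpha_ge0.
have mF : measurable F.
  have -> : F = ([set xi : seq_space | mu_generic a xi] `&`
      [set xi : seq_space | H_set A xi g]) `|`
      (~` [set xi : seq_space | mu_generic a xi] `&` [set xi : seq_space | g = 1%g]).
    apply/seteqP; split=> xi.
      have [gen|gen] := pselect (mu_generic a xi).
        by move=> /FE h; left; split=> //; exact: h.
      by move=> /FNE h; right; split=> //; exact: h.
    by move=> [[gen h]|[gen h]]; [apply/FE|apply/FNE].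
  apply: measurableU; apply: measurableI => //; first exact: measurableC.
  have [g1|g1] := pselect (g = 1%g).
    by rewrite (_ : [set _ | _] = setT) //; apply/seteqP; split.
  by rewrite (_ : [set _ | _] = set0) //; apply/seteqP; split.
have -> : mu [set xi : seq_space | H_set A xi g] = mu F.
  have [Z [mZ Z0 ZP]] := ae_generic prod_mu alpha_ge0.
  rewrite -(measureU0 mH mZ Z0) -(measureU0 mF mZ Z0); congr (mu _).
  apply/seteqP; split=> xi [h|h]; try by right.
    have [gen|gen] := pselect (mu_generic a xi); last by right; exact: ZP.
    by left; apply/FE.
  have [gen|gen] := pselect (mu_generic a xi); last by right; exact: ZP.
  by left; apply/FE.
rewrite /nu_alpha; case: ifPn => // /eqP a0.
have I0 i : I i = false.
  apply/negbTE/negP => /andP[i0 ai].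
  have := sum_alpha_le1 prod_mu alpha_ge0 i.+1.
  rewrite big_ord_recr; case: i i0 ai => // i _ ai; rewrite big_ord_recl.
  have -> : alpha a (widen_ord (leqnSn i.+1) ord0) = 1 by exact: a0.
  rewrite /= -addrA gerDl; apply/negP; rewrite -ltNge.
  by apply: ltr_wpDl => //; apply: sumr_ge0 => k _; exact: (alpha_ge0 k.+1).
have H1 xi : H_set A xi g -> g = 1%g.
  move=> [p [_ gp _]]; apply: fin_eqP => n.
  by rewrite (gp (xi n) n erefl) rd_out // I0.
rewrite diracE; have [g1|g1] := pselect (g = 1%g).
  rewrite mem_set; last exact/trivE.
  rewrite (_ : F = setT) ?probability_setT //; apply/seteqP; split=> // xi _.
  have [gen|gen] := pselect (mu_generic a xi); last exact/FNE.
  by apply/FE => //; rewrite g1; exact: H_set1.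
rewrite memNset; last by move=> /trivE.
rewrite (_ : F = set0) ?measure0 //; apply/seteqP; split=> // xi.
have [gen|gen] := pselect (mu_generic a xi); last by move/FNE => /(_ gen).
by move/FE => /(_ gen)/H1.
Qed.

End colour_expansion.

Arguments colourings {R} a g K.

(** * Expansion of the averaged characters *)

Section pm1_values.
Context (R : realType).

Lemma pm1_valM (x y : pm1) : pm1_val (x * y)%g = pm1_val x * pm1_val y :> R.
Proof. exact: signr_addb. Qed.

Lemma norm_pm1_val (x : pm1) : `|pm1_val x : R| = 1.
Proof. by rewrite /pm1_val normr_sign. Qed.

Context (S : groupType) (A : set S) (sigma : pm1_dual A).

Lemma pm1_val_dual1 : pm1_val (sigma 1%g) = 1 :> R.
Proof.
suff -> : sigma 1%g = 1%g by [].
by apply: (@mulgI _ (sigma 1%g)); rewrite -dual_morph !mulg1.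
Qed.

Lemma pm1_val_dualM x y :
  pm1_val (sigma (x * y)%g) = pm1_val (sigma x) * pm1_val (sigma y) :> R.
Proof. by rewrite dual_morph pm1_valM. Qed.

Lemma pm1_val_dualX x n : pm1_val (sigma (x ^+ n)%g) = pm1_val (sigma x) ^+ n :> R.
Proof.
elim: n => [|n IH]; first by rewrite expg0 expr0 pm1_val_dual1.
by rewrite expgS exprS pm1_val_dualM IH.
Qed.

End pm1_values.

Section truncated_character.
Context (R : realType) (a : nat -> R) (mu : probability seq_space R).
Hypothesis (prod_mu : is_product_measure a mu).
Hypothesis (alpha_ge0 : forall i, 0 <= alpha a i).
Context (A : SubSpace (S_alpha a)) (g : Fin).

Local Notation J := (cycles (fin_perm g)).
Local Notation I := (index_set a).

Definition chi_term (sigma : S_alpha a -> pm1) (k i : nat) : R :=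
  pm1_val (sigma (rd_gen I i)) ^+ k.+1 * alpha a i ^+ k.

Definition chi_trunc (sigma : S_alpha a -> pm1) (K : nat) : R :=
  \prod_(C in J) \sum_(i < K.+1 | I i) chi_term sigma #|C| i.

(** Expanding the product of sums turns a choice of colour for every cycle into a
    colouring, and the product of the values of [sigma] on generators into its
    value on the sign vector. *)
Lemma chi_truncE (sigma : pm1_dual (mem_subgroup A)) K :
  chi_trunc sigma K = \sum_(f in colourings a g K)
    colour_weight a (colour_fun f) * pm1_val (sigma (colour_sign a f)).
Proof.
rewrite /chi_trunc (big_distr_big_dep ord0); apply: eq_bigr => f fK.
rewrite /colour_sign /sign_vector.
rewrite (big_morph (fun s => pm1_val (sigma s) : R) (pm1_val_dualM R sigma)
  (pm1_val_dual1 R sigma)).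
rewrite /colour_weight -big_split; apply: eq_bigr => C _ /=.
by rewrite pm1_val_dualX mulrC.
Qed.

Lemma norm_chi_term sigma k i : (0 < k)%N -> `|chi_term sigma k i| <= alpha a i.
Proof.
case: k => // k _; rewrite normrM normrX norm_pm1_val expr1n mul1r.
rewrite ger0_norm ?exprn_ge0 // exprS ler_piMr // exprn_ile1 //.
exact: (alpha_le1 prod_mu).
Qed.

Lemma cycles_card_gt0 C : C \in J -> (0 < #|C|)%N.
Proof. by rewrite inE => /andP[_ /ltnW]. Qed.

Lemma norm_chi_trunc sigma K : `|chi_trunc sigma K| <= 1.
Proof.
rewrite normr_prod; apply: prodr_ile1 => C /cycles_card_gt0 C0.
rewrite normr_ge0 /=; apply: le_trans (ler_norm_sum _ _ _) _.
apply: le_trans (sum_alpha_le1 prod_mu alpha_ge0 K.+1).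
rewrite big_mkcond; apply: ler_sum => i _.
by case: ifP => // _; exact: norm_chi_term.
Qed.

Lemma index_set_sum (u : nat -> R) n :
  \sum_(1 <= i < n | I i) u i = series (fun i => if I i then u i else 0) n.
Proof.
rewrite /series /= -big_mkcond; case: n => [|n]; first by rewrite !big_nil.
by rewrite [RHS]big_ltn_cond.
Qed.

Lemma chi_sum_cvg sigma k : (0 < k)%N ->
  \sum_(i < K.+1 | I i) chi_term sigma k i @[K --> \oo] -->
  \big[+%R/0]_(1 <= i <oo | I i) chi_term sigma k i.
Proof.
move=> k0; pose u i := if I i then chi_term sigma k i else 0.
have sE K : \sum_(i < K.+1 | I i) chi_term sigma k i = series u K.+1.
  by rewrite /series /= -big_mkcond big_mkord.
under eq_fun do rewrite sE.
have -> : \big[+%R/0]_(1 <= i <oo | I i) chi_term sigma k i = limn (series u).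
  by congr (limn _); apply/funext => n; exact: index_set_sum.
have cu : cvgn (series u).
  apply: normed_cvg; apply: (@series_le_cvg _ _ (alpha a)) => [i|//|i|].
  - exact: normr_ge0.
  - rewrite /u /=; case: ifP => _; last by rewrite normr0.
    exact: norm_chi_term.
  - apply: nondecreasing_is_cvgn.
      by apply: nondecreasing_series => j _ _; exact: alpha_ge0.
    exists 1 => _ [n _ <-]; rewrite /series /= big_mkord.
    exact: (sum_alpha_le1 prod_mu).
exact: (eq_ind_r id cu (cvg_shiftS (series u) _)).
Qed.

(** The factor of index [k] is a product over the cycles of length [k]; no cycle
    is longer than [fin_bound g], so the partial products are eventually
    constant. *)
Lemma chi_alphaE sigma : chi_alpha a sigma g =
  \prod_(C in J) \big[+%R/0]_(1 <= i <oo | I i) chi_term sigma #|C| i.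
Proof.
rewrite /chi_alpha; set psi := fun k => \big[+%R/0]_(1 <= i <oo | I i) chi_term sigma k i.
apply: lim_near_cst => //; exists (fin_bound g).+1 => // n /= Nn.
transitivity (\prod_(2 <= k < n) \prod_(C in J | #|C| == k) psi k).
  apply: eq_big_nat => k /andP[k2 _]; rewrite prodr_const; congr (_ ^+ _).
  apply: eq_card => C; rewrite !inE [RHS]unfold_in inE andbAC.
  by case: eqP => [->|_]; rewrite ?andbF ?andbT // k2 andbT.
rewrite (exchange_big_dep (mem J)) /= => [|k C _ /andP[]//].
apply: eq_bigr => C CJ.
under eq_bigl do rewrite CJ /= eq_sym.
rewrite big_nat1_eq; case: ifP => // /negP[].
move: CJ; rewrite inE => /andP[_ ->] /=.
by rewrite (leq_ltn_trans _ Nn) // (leq_trans (max_card _)) // card_ord.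
Qed.

Lemma chi_trunc_cvg sigma : chi_trunc sigma K @[K --> \oo] --> chi_alpha a sigma g.
Proof.
rewrite chi_alphaE; apply: cvg_big; first exact: mul_continuous.
by move=> C /cycles_card_gt0 C0; exact: chi_sum_cvg.
Qed.

Context (m : probability (borel (pm1_dual (mem_subgroup A))) R).
Hypothesis (haar : is_haar m).

Lemma S_alpha_exponent2 (x : S_alpha a) : (x * x)%g = 1%g.
Proof. by apply: rd_eqP => i; exact: addbb. Qed.

(** Orthogonality keeps exactly the colourings whose sign vector lies in [A],
    which are those whose cylinder is contained in the event that [g] belongs to
    the random subgroup. *)
Lemma integral_chi_trunc K :
  (\int[m]_sigma (chi_trunc (sigma : pm1_dual (mem_subgroup A)) K)%:E)%E =
  mu (bounded_event A g K).
Proof.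
have [_ ->] := bounded_event_measure prod_mu alpha_ge0 A g K.
under eq_integral do rewrite chi_truncE -sumEFin.
rewrite integral_sum //; last first.
  move=> f; under eq_fun do rewrite EFinM.
  by apply: integrableZl => //; exact: integrable_dual_eval.
rewrite -sumEFin; apply: eq_bigr => f _.
under eq_integral do rewrite EFinM.
rewrite integralZl //; last exact: integrable_dual_eval.
by rewrite (integral_dual_eval _ S_alpha_exponent2 haar).
Qed.

Lemma measurable_chi_trunc K : measurable_fun setT
  (fun sigma : borel (pm1_dual (mem_subgroup A)) =>
     (chi_trunc (sigma : pm1_dual (mem_subgroup A)) K)%:E).
Proof.
under eq_fun do rewrite chi_truncE -sumEFin.
apply: (measurable_int m); apply: integrable_sum => // f _.
under eq_fun do rewrite EFinM.
by apply: integrableZl => //; exact: integrable_dual_eval.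
Qed.

Lemma integral_chi_trunc_cvg :
  (\int[m]_sigma (chi_trunc (sigma : pm1_dual (mem_subgroup A)) K)%:E)%E
    @[K --> \oo] -->
  (\int[m]_sigma (chi_alpha a (sigma : pm1_dual (mem_subgroup A)) g)%:E)%E.
Proof.
have chi_cvg (sigma : borel (pm1_dual (mem_subgroup A))) :
    (chi_trunc (sigma : pm1_dual (mem_subgroup A)) K)%:E @[K --> \oo] -->
    (chi_alpha a (sigma : pm1_dual (mem_subgroup A)) g)%:E.
  by apply: cvg_EFin; [exact: nearW|exact: chi_trunc_cvg].
have [] := @dominated_convergence _ _ _ m setT measurableT
  (fun K sigma => (chi_trunc (sigma : pm1_dual (mem_subgroup A)) K)%:E)
  (fun sigma => (chi_alpha a (sigma : pm1_dual (mem_subgroup A)) g)%:E)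
  (cst 1%E).
- exact: measurable_chi_trunc.
- apply: (@emeasurable_fun_cvg _ _ _ setT
    (fun K (sigma : borel (pm1_dual (mem_subgroup A))) =>
       (chi_trunc (sigma : pm1_dual (mem_subgroup A)) K)%:E)).
    exact: measurable_chi_trunc.
  by move=> sigma _; exact: chi_cvg.
- by apply: aeW => sigma _; exact: chi_cvg.
- exact: finite_measure_integrable_cst.
- by apply: aeW => sigma K _; rewrite lee_fin norm_chi_trunc.
- by [].
Qed.

End truncated_character.

Lemma alpha_nonneg (R : realType) (a : nat -> R) : D01 a ->
  (\sum_(0 <= i <oo) (a i)%:E <= 1)%E -> forall i, 0 <= alpha a i.
Proof.
move=> [a01 _] s1 [|i]; last by rewrite /=; case/andP: (a01 i).
rewrite /= subr_ge0; have s0 : (0 <= \sum_(0 <= i <oo) (a i)%:E)%E.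
  by apply: nneseries_ge0 => i _ _; rewrite lee_fin; case/andP: (a01 i).
by rewrite -lee_fin fineK // ge0_fin_numE // (le_lt_trans s1) // ltry.
Qed.

Unset Implicit Arguments.

Theorem theorem1p7 (R : realType) (a : nat -> R) (A : SubSpace (S_alpha a))
  (mu : probability seq_space R)
  (m : probability (borel (pm1_dual (mem_subgroup A))) R) :
  D01 a ->
  (\sum_(0 <= i <oo) (a i)%:E <= 1)%E ->
  is_product_measure a mu ->
  is_haar m ->
  forall g : Fin,
    character (nu_alpha A mu) g =
    (\int[m]_sigma (chi_alpha a (sigma : pm1_dual (mem_subgroup A)) g)%:E)%E.
Proof.
move=> aD a1 prod_mu haar g; have alpha_ge0 := alpha_nonneg aD a1.
rewrite (character_H_event prod_mu alpha_ge0).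
have [_ muK] := H_event_limit prod_mu alpha_ge0 A g.
have := integral_chi_trunc_cvg prod_mu alpha_ge0 (g:=g) (m:=m).
under eq_fun do rewrite (integral_chi_trunc prod_mu alpha_ge0 g haar).
by move/(cvg_unique (@ereal_hausdorff R) muK).
Qed.
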